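(* Let $\mathbb{K}$ be an algebraically closed field and let $Y$ be a cocommutative bialgebra over $\mathbb{K}$. Then the following conditions are equivalent: (i) $Y$ is a Hopf algebra; (ii) in $\mathsf{BiAlg}_{\mathbb{K},\mathit{coc}}$, all split extensions over $Y$ admit a join decomposition; (iii) $Y$ is a protomodular object in $\mathsf{BiAlg}_{\mathbb{K},\mathit{coc}}$.
   Context: $\mathsf{BiAlg}_{\mathbb{K},\mathit{coc}}$ is the category of cocommutative $\mathbb{K}$-bialgebras (associative, unital, coassociative, counital), with bialgebra morphisms (algebra and coalgebra maps preserving units and counits). It is a pointed category with finite limits, with zero object $\mathbb{K}$. A Hopf algebra is a bialgebra that admits an antipode. In a pointed category with finite limits: A split extension over $Y$ is a diagram consisting of morphisms $k\colon K\to X$, $f\colon X\to Y$, $s\colon Y\to X$ such that $k$ is a (categorical) kernel of $f$ and $f\circ s=1_Y$ (it is not required that $f$ be a cokernel of $k$). A pair of arrows $(k\colon K\to X,\ s\colon Y\to X)$ is jointly extremally epimorphic when, for every monomorphism $m\colon M\to X$ such that both $k$ and $s$ factor through $m$, the morphism $m$ is an isomorphism. A split extension $(k,f,s)$ is strong, or admits a join decomposition, when $(k,s)$ is jointly extremally epimorphic. The pullback of a split extension $(k,f,s)$ over $Y$ along $g\colon W\to Y$ is the split extension over $W$ given by the pullback projection $\pi_1\colon W\times_Y X\to W$, its section $\langle 1_W, s\circ g\rangle$, and the kernel of $\pi_1$. A split extension over $Y$ is stably strong when all of its pullbacks along all morphisms $g\colon W\to Y$ are strong. An object $Y$ is protomodular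 when all split extensions over $Y$ are stably strong. *)

(* Defs.v *)
From HB Require Import structures.
From mathcomp Require Import all_boot all_algebra.
From mathcomp Require Import boolp.

Set Implicit Arguments.
Unset Strict Implicit.
Unset Printing Implicit Defensive.

Import GRing.Theory.
Local Open Scope ring_scope.
Local Open Scope quotient_scope.

Declare Scope cat_scope.
Delimit Scope cat_scope with cat.

(* Tensor product of (possibly infinite-dimensional) vector spaces.          *)
(* A formal sum of pure tensors is a sequence of pairs; two formal sums are  *)
(* identified when every bilinear map takes the same value on them. The      *)
(* universal property is given by tlift, tliftE and tensor_linear_ext.       *)

Section Tensor.
Variables (K : fieldType) (V W : lmodType K).

Definition fsum (U : lmodType K) (f : V -> W -> U) (s : seq (V * W)) : U :=
  \sum_(p <- s) f p.1 p.2.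

Definition tensor_eq (s t : seq (V * W)) : bool :=
  `[< forall (U : lmodType K) (f : {bilinear V -> W -> U}),
        fsum f s = fsum f t >].

Fact tensor_eq_refl : reflexive tensor_eq.
Proof. by move=> s; apply/asboolP. Qed.

Fact tensor_eq_sym : symmetric tensor_eq.
Proof. by move=> s t; apply/asboolP/asboolP => h U f; rewrite h. Qed.

Fact tensor_eq_trans : transitive tensor_eq.
Proof.
by move=> t s u /asboolP h1 /asboolP h2; apply/asboolP => U f; rewrite h1 h2.
Qed.

Canonical tensor_equiv :=
  EquivRel tensor_eq tensor_eq_refl tensor_eq_sym tensor_eq_trans.

Definition tensor := {eq_quot tensor_equiv}.
HB.instance Definition _ := Choice.on tensor.
HB.instance Definition _ := EqQuotient.on tensor.

Definition tens (v : V) (w : W) : tensor := \pi_tensor [:: (v, w)].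

Lemma tensor_piP (s t : seq (V * W)) :
  (forall (U : lmodType K) (f : {bilinear V -> W -> U}),
     fsum f s = fsum f t) <-> \pi_tensor s = \pi_tensor t.
Proof.
split=> [h|/eqmodP/asboolP//]; by apply/eqmodP/asboolP.
Qed.

Lemma tensor_piW (P : tensor -> Prop) :
  (forall s, P (\pi_tensor s)) -> forall x, P x.
Proof. by move=> h x; rewrite -[x]reprK. Qed.

Lemma fsum_repr (U : lmodType K) (f : {bilinear V -> W -> U}) s :
  fsum f (repr (\pi_tensor s)) = fsum f s.
Proof. by move: U f; apply/tensor_piP; rewrite reprK. Qed.

Lemma fsum_cat (U : lmodType K) (f : V -> W -> U) s t :
  fsum f (s ++ t) = fsum f s + fsum f t.
Proof. exact: big_cat. Qed.

Definition scale_fsum (c : K) (s : seq (V * W)) :=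
  [seq (c *: p.1, p.2) | p <- s].

Lemma fsum_scale (U : lmodType K) (f : {bilinear V -> W -> U}) c s :
  fsum f (scale_fsum c s) = c *: fsum f s.
Proof.
rewrite /fsum big_map scaler_sumr; apply: eq_bigr => p _ /=.
by rewrite linearZl_LR.
Qed.

Definition tzero : tensor := \pi_tensor [::].
Definition tadd (x y : tensor) : tensor := \pi_tensor (repr x ++ repr y).
Definition tscale (c : K) (x : tensor) : tensor :=
  \pi_tensor (scale_fsum c (repr x)).
Definition topp (x : tensor) : tensor := tscale (-1) x.

Lemma tadd_pi s t : tadd (\pi_tensor s) (\pi_tensor t) = \pi_tensor (s ++ t).
Proof. by apply/tensor_piP => U f; rewrite !fsum_cat !fsum_repr. Qed.

Lemma tscale_pi c s : tscale c (\pi_tensor s) = \pi_tensor (scale_fsum c s).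
Proof. by apply/tensor_piP => U f; rewrite !fsum_scale fsum_repr. Qed.

Fact taddA : associative tadd.
Proof.
elim/tensor_piW=> s; elim/tensor_piW=> t; elim/tensor_piW=> u.
by rewrite !tadd_pi catA.
Qed.

Fact taddC : commutative tadd.
Proof.
elim/tensor_piW=> s; elim/tensor_piW=> t; rewrite !tadd_pi; apply/tensor_piP => U f.
by rewrite !fsum_cat addrC.
Qed.

Fact tadd0 : left_id tzero tadd.
Proof. by elim/tensor_piW=> s; rewrite tadd_pi. Qed.

Fact taddN : left_inverse tzero topp tadd.
Proof.
elim/tensor_piW=> s; rewrite /topp tscale_pi tadd_pi; apply/tensor_piP => U f.
by rewrite fsum_cat fsum_scale scaleN1r addNr /fsum big_nil.
Qed.

HB.instance Definition _ := GRing.isZmodule.Build tensor taddA taddC tadd0 taddN.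

Fact tscaleA a b x : tscale a (tscale b x) = tscale (a * b) x.
Proof.
elim/tensor_piW: x => s; rewrite !tscale_pi; apply/tensor_piP => U f.
by rewrite !fsum_scale scalerA.
Qed.

Fact tscale1 : left_id 1 tscale.
Proof.
elim/tensor_piW=> s; rewrite tscale_pi; apply/tensor_piP => U f.
by rewrite fsum_scale scale1r.
Qed.

Fact tscaleDr : right_distributive tscale +%R.
Proof.
move=> c; elim/tensor_piW=> s; elim/tensor_piW=> t.
rewrite -[_ + _]/(tadd _ _) -[RHS]/(tadd _ _) tadd_pi !tscale_pi tadd_pi.
by rewrite /scale_fsum map_cat.
Qed.

Fact tscaleDl x : {morph tscale^~ x : a b / a + b}.
Proof.
move=> a b; elim/tensor_piW: x => s; rewrite -[RHS]/(tadd _ _) !tscale_pi tadd_pi.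
by apply/tensor_piP => U f; rewrite fsum_cat !fsum_scale scalerDl.
Qed.

HB.instance Definition _ :=
  GRing.Zmodule_isLmodule.Build K tensor tscaleA tscale1 tscaleDr tscaleDl.

Fact tens_bilinear : bilinear_for *:%R *:%R tens.
Proof.
split=> [w c u v|v c u w]; rewrite -[RHS]/(tadd (tscale _ _) _) tscale_pi
  tadd_pi; apply/tensor_piP => U f; rewrite fsum_cat fsum_scale /fsum !big_seq1.
  by rewrite /= linearPl.
by rewrite /= linearPr.
Qed.

HB.instance Definition _ := bilinear_isBilinear.Build K V W tensor _ _ tens
  tens_bilinear.

Lemma pi_tensorE s : \pi_tensor s = \sum_(p <- s) tens p.1 p.2.
Proof.
elim: s => [|[v w] s IHs]; first by rewrite big_nil.
by rewrite big_cons /= -IHs -[_ + _]/(tadd _ _) tadd_pi.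
Qed.

Lemma tensor_ind (P : tensor -> Prop) :
  P 0 -> (forall v w x, P x -> P (tens v w + x)) -> forall x, P x.
Proof.
move=> P0 PD; elim/tensor_piW=> s; rewrite pi_tensorE.
by elim: s => [|p s IHs]; rewrite (big_nil, big_cons) //; apply: PD.
Qed.

Section Lift.
Variables (U : lmodType K) (f : {bilinear V -> W -> U}).

Definition tlift (x : tensor) : U := fsum f (repr x).

Fact tlift_linear : linear tlift.
Proof.
move=> c; elim/tensor_piW=> s; elim/tensor_piW=> t.
rewrite -[_ + _]/(tadd (tscale _ _) _) tscale_pi tadd_pi /tlift !fsum_repr.
by rewrite fsum_cat fsum_scale.
Qed.

HB.instance Definition _ :=
  GRing.isLinear.Build K tensor U *:%R tlift tlift_linear.

Lemma tliftE v w : tlift (tens v w) = f v w.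
Proof. by rewrite /tlift fsum_repr /fsum big_seq1. Qed.

End Lift.

Lemma tensor_linear_ext (U : lmodType K) (f g : {linear tensor -> U}) :
  (forall v w, f (tens v w) = g (tens v w)) -> f =1 g.
Proof.
move=> fg; elim/tensor_ind => [|v w x IHx]; first by rewrite !linear0.
by rewrite !linearD fg IHx.
Qed.

End Tensor.

Notation "V ⊗ W" := (tensor V W)
  (at level 40, left associativity) : type_scope.

Section TensorMaps.
Variable K : fieldType.
Implicit Types U V W : lmodType K.

Section Map.
Variables (V V' W W' : lmodType K).
Variables (f : {linear V -> V'}) (g : {linear W -> W'}).

Definition tmap_pre (v : V) (w : W) : V' ⊗ W' := tens (f v) (g w).

Fact tmap_pre_bilinear : bilinear_for *:%R *:%R tmap_pre.
Proof.
by split=> [w|v] c x y; rewrite /tmap_pre linearP (linearPl, linearPr).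
Qed.

HB.instance Definition _ := bilinear_isBilinear.Build K V W (V' ⊗ W')%type
  _ _ tmap_pre tmap_pre_bilinear.

Definition tmap : V ⊗ W -> V' ⊗ W' := tlift tmap_pre.
HB.instance Definition _ := GRing.Linear.on tmap.

Lemma tmapE v w : tmap (tens v w) = tens (f v) (g w).
Proof. exact: tliftE. Qed.

End Map.

Section Swap.
Variables (V W : lmodType K).

Definition tswap_pre (v : V) (w : W) : W ⊗ V := tens w v.

Fact tswap_pre_bilinear : bilinear_for *:%R *:%R tswap_pre.
Proof. by split=> [w|v] c x y; rewrite /tswap_pre (linearPl, linearPr). Qed.

HB.instance Definition _ := bilinear_isBilinear.Build K V W (W ⊗ V)%type
  _ _ tswap_pre tswap_pre_bilinear.

Definition tswap : V ⊗ W -> W ⊗ V := tlift tswap_pre.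
HB.instance Definition _ := GRing.Linear.on tswap.

Lemma tswapE v w : tswap (tens v w) = tens w v.
Proof. exact: tliftE. Qed.

End Swap.

Section Assoc.
Variables (U V W : lmodType K).

Definition tassoc_pre2 (w : W) (u : U) (v : V) : U ⊗ (V ⊗ W) :=
  tens u (tens v w).

Fact tassoc_pre2_bilinear w : bilinear_for *:%R *:%R (tassoc_pre2 w).
Proof.
split=> [v|u] c x y; rewrite /tassoc_pre2; first by rewrite linearPl.
by rewrite linearPl linearPr.
Qed.

HB.instance Definition _ w := bilinear_isBilinear.Build K U V
  (U ⊗ (V ⊗ W))%type _ _ (tassoc_pre2 w) (tassoc_pre2_bilinear w).

Definition tassoc_pre (t : U ⊗ V) (w : W) : U ⊗ (V ⊗ W) :=
  tlift (tassoc_pre2 w) t.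

Fact tassoc_pre_bilinear : bilinear_for *:%R *:%R tassoc_pre.
Proof.
split=> [w|t] c x y; rewrite /tassoc_pre; first by rewrite linearP.
elim/tensor_ind: t => [|u v t IHt]; first by rewrite !linear0 /= scaler0 addr0.
rewrite !linearD /= IHt !tliftE /= scalerDr addrACA; congr (_ + _).
by rewrite /tassoc_pre2 !linearPr.
Qed.

HB.instance Definition _ := bilinear_isBilinear.Build K (U ⊗ V)%type W
  (U ⊗ (V ⊗ W))%type _ _ tassoc_pre tassoc_pre_bilinear.

Definition tassoc : (U ⊗ V) ⊗ W -> U ⊗ (V ⊗ W) := tlift tassoc_pre.
HB.instance Definition _ := GRing.Linear.on tassoc.

Lemma tassocE u v w : tassoc (tens (tens u v) w) = tens u (tens v w).
Proof. by rewrite /tassoc tliftE /= /tassoc_pre tliftE. Qed.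

End Assoc.

End TensorMaps.

(* A ⊗ B is declared as a pzRingType only, because nzRingType would require  *)
(* a proof that 1 ⊗ 1 != 0.                                                  *)

Section TensorAlgebra.
Variable K : fieldType.

Definition mull (A : algType K) (a x : A) : A := a * x.

Fact mull_bilinear (A : algType K) : bilinear_for *:%R *:%R (@mull A).
Proof.
split=> [x|x] c a b; rewrite /mull; first by rewrite mulrDl /= scalerAl.
by rewrite mulrDr /= scalerAr.
Qed.

HB.instance Definition _ (A : algType K) :=
  bilinear_isBilinear.Build K A A A _ _ (@mull A) (@mull_bilinear A).

HB.instance Definition _ (A : algType K) (a : A) :=
  GRing.isLinear.Build K A A *:%R (mull a) ((mull_bilinear A).2 a).

Definition tmult (A : algType K) : A ⊗ A -> A := tlift (@mull A).
HB.instance Definition _ (A : algType K) := GRing.Linear.on (@tmult A).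

Lemma tmultE (A : algType K) (a b : A) : tmult (tens a b) = a * b.
Proof. exact: tliftE. Qed.

Variables A B : algType K.

Definition tmul_pre (y : A ⊗ B) (a : A) (b : B) : A ⊗ B :=
  tmap (mull a) (mull b) y.

Fact tmul_pre_bilinear y : bilinear_for *:%R *:%R (tmul_pre y).
Proof.
split=> [b|a] c x x'; rewrite /tmul_pre.
  elim/tensor_ind: y => [|u v t IHt]; first by rewrite !linear0 /= scaler0 addr0.
  rewrite !linearD /= IHt !tmapE scalerDr addrACA; congr (_ + _).
  by rewrite /= /mull mulrDl -scalerAl linearPl.
elim/tensor_ind: y => [|u v t IHt]; first by rewrite !linear0 /= scaler0 addr0.
rewrite !linearD /= IHt !tmapE scalerDr addrACA; congr (_ + _).
by rewrite /= /mull mulrDl -scalerAl linearPr.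
Qed.

HB.instance Definition _ y := bilinear_isBilinear.Build K A B (A ⊗ B)%type
  _ _ (tmul_pre y) (tmul_pre_bilinear y).

Definition tone : A ⊗ B := tens 1 1.
Definition tmul (x y : A ⊗ B) : A ⊗ B := tlift (tmul_pre y) x.

Lemma tmul_tens a b a' b' :
  tmul (tens a b) (tens a' b') = tens (a * a') (b * b').
Proof. by rewrite /tmul tliftE /= /tmul_pre tmapE. Qed.

Lemma tmul0 x : tmul x 0 = 0.
Proof.
rewrite /tmul; elim/tensor_ind: x => [|a b x IHx]; first by rewrite linear0.
by rewrite linearD /= IHx tliftE /= /tmul_pre linear0 addr0.
Qed.

Fact tmulDl : left_distributive tmul +%R.
Proof. by move=> x y z; rewrite /tmul linearD. Qed.

Fact tmulDr : right_distributive tmul +%R.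
Proof.
move=> x y z; rewrite /tmul; elim/tensor_ind: x => [|a b x IHx].
  by rewrite !linear0 addr0.
by rewrite !linearD /= IHx !tliftE /= /tmul_pre linearD addrACA.
Qed.

Fact tmulA : associative tmul.
Proof.
have t0 y : tmul 0 y = 0 by rewrite /tmul linear0.
move=> x y z; elim/tensor_ind: x => [|a b x IHx]; first by rewrite !t0.
rewrite !tmulDl IHx; congr (_ + _) => {IHx}.
elim/tensor_ind: y => [|a' b' y IHy]; first by rewrite t0 tmul0 t0.
rewrite !(tmulDl, tmulDr) IHy; congr (_ + _) => {IHy}.
elim/tensor_ind: z => [|a'' b'' z IHz]; first by rewrite !tmul0.
by rewrite !tmulDr IHz !tmul_tens !mulrA.
Qed.

Fact tmul1l : left_id tone tmul.
Proof.
elim/tensor_ind=> [|a b x IHx]; first by rewrite tmul0.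
by rewrite tmulDr IHx tmul_tens !mul1r.
Qed.

Fact tmul1r : right_id tone tmul.
Proof.
elim/tensor_ind=> [|a b x IHx]; first by rewrite /tmul linear0.
by rewrite tmulDl IHx tmul_tens !mulr1.
Qed.

HB.instance Definition _ := GRing.Zmodule_isPzRing.Build (A ⊗ B)%type
  tmulA tmul1l tmul1r tmulDl tmulDr.

Lemma tens1 : tens (1 : A) (1 : B) = 1.
Proof. by []. Qed.

Lemma tensM (a a' : A) (b b' : B) :
  tens a b * tens a' b' = tens (a * a') (b * b').
Proof. exact: tmul_tens. Qed.

End TensorAlgebra.

(* The counit axioms are read through K ⊗ C = C = C ⊗ K.                     *)
HB.mixin Record Lmodule_isCoalgebra (K : fieldType) C of GRing.Lmodule K C := {
  comul : {linear C -> (C ⊗ C)%type};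
  counit : {linear C -> K^o};
  comulA : forall x : C,
    tassoc (tmap comul idfun (comul x)) = tmap idfun comul (comul x);
  counitl : forall x : C, tmap counit idfun (comul x) = tens (1 : K^o) x;
  counitr : forall x : C, tmap idfun counit (comul x) = tens x (1 : K^o)
}.

#[short(type="coalgType")]
HB.structure Definition Coalgebra (K : fieldType) :=
  {C of GRing.Lmodule K C & Lmodule_isCoalgebra K C}.

HB.mixin Record Coalgebra_isCocommutative (K : fieldType) C of Coalgebra K C := {
  comulC : forall x : C, tswap (comul x) = comul x
}.

#[short(type="cocCoalgType")]
HB.structure Definition CocCoalgebra (K : fieldType) :=
  {C of Coalgebra K C & Coalgebra_isCocommutative K C}.

HB.mixin Record Coalgebra_isBialgebra (K : fieldType) A
    of GRing.Algebra K A & Coalgebra K A := {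
  comul1 : comul (1 : A) = 1;
  comulM : forall x y : A, comul (x * y) = comul x * comul y;
  counit1 : counit (1 : A) = 1;
  counitM : forall x y : A, counit (x * y) = counit x * counit y
}.

(* The requirement 1 != 0 in algType K is no restriction, because            *)
(* counit 1 = 1 != 0 in K.                                                   *)
#[short(type="bialgType")]
HB.structure Definition Bialgebra (K : fieldType) :=
  {A of GRing.Algebra K A & Coalgebra K A & Coalgebra_isBialgebra K A}.

#[short(type="cocBialgType")]
HB.structure Definition CocBialgebra (K : fieldType) :=
  {A of Bialgebra K A & CocCoalgebra K A}.

Definition is_antipode (K : fieldType) (A : bialgType K) (S : {linear A -> A}) :=
  (forall x : A, tmult (tmap S idfun (comul x)) = counit x *: 1) /\
  (forall x : A, tmult (tmap idfun S (comul x)) = counit x *: 1).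

Definition is_hopf (K : fieldType) (A : bialgType K) :=
  exists S : {linear A -> A}, is_antipode S.

Record category := Category {
  obj :> Type;
  hom : obj -> obj -> Type;
  cid : forall X, hom X X;
  ccomp : forall X Y Z, hom Y Z -> hom X Y -> hom X Z;
  ccompA : forall X Y Z T (h : hom Z T) (g : hom Y Z) (f : hom X Y),
    ccomp h (ccomp g f) = ccomp (ccomp h g) f;
  ccomp1l : forall X Y (f : hom X Y), ccomp (cid Y) f = f;
  ccomp1r : forall X Y (f : hom X Y), ccomp f (cid X) = f
}.

Arguments cid {c} X.
Notation "g ∘ f" := (ccomp g f) (at level 40, left associativity) : cat_scope.
Local Open Scope cat_scope.

Section CategoryTheory.
Variable C : category.

Definition is_zero_obj (Z : C) :=
  forall X : C, (exists! f : hom Z X, True) /\ (exists! f : hom X Z, True).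

(* In a pointed category this says that h is the zero morphism; the zero     *)
(* object of BiAlg_coc is given by base_is_zero_obj.                         *)
Definition is_zero_mor (X Y : C) (h : hom X Y) :=
  exists (Z : C) (a : hom X Z) (b : hom Z Y), is_zero_obj Z /\ h = b ∘ a.

Definition is_iso (X Y : C) (f : hom X Y) :=
  exists g : hom Y X, g ∘ f = cid X /\ f ∘ g = cid Y.

Definition is_mono (X Y : C) (m : hom X Y) :=
  forall (T : C) (u v : hom T X), m ∘ u = m ∘ v -> u = v.

Definition is_kernel (N X Y : C) (k : hom N X) (f : hom X Y) :=
  is_zero_mor (f ∘ k) /\
  forall (T : C) (h : hom T X), is_zero_mor (f ∘ h) ->
    exists! u : hom T N, k ∘ u = h.

Definition is_pullback (P W X Y : C) (g : hom W Y) (f : hom X Y)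
    (p1 : hom P W) (p2 : hom P X) :=
  g ∘ p1 = f ∘ p2 /\
  forall (T : C) (u : hom T W) (v : hom T X), g ∘ u = f ∘ v ->
    exists! t : hom T P, p1 ∘ t = u /\ p2 ∘ t = v.

Definition jointly_extremally_epi (N X Y : C) (k : hom N X) (s : hom Y X) :=
  forall (M : C) (m : hom M X), is_mono m ->
    (exists k' : hom N M, m ∘ k' = k) -> (exists s' : hom Y M, m ∘ s' = s) ->
    is_iso m.

Record split_ext (Y : C) := SplitExt {
  se_ker : C;
  se_tot : C;
  se_k : hom se_ker se_tot;
  se_f : hom se_tot Y;
  se_s : hom Y se_tot;
  se_kernel : is_kernel se_k se_f;
  se_section : se_f ∘ se_s = cid Y
}.

Definition strong (Y : C) (E : split_ext Y) :=
  jointly_extremally_epi (se_k E) (se_s E).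

(* Pullbacks being unique up to isomorphism only, this is a relation: E' is  *)
(* a pullback of E along g. The equation on sections, together with          *)
(* se_section E', says that se_s E' is the map <1, se_s E ∘ g>.              *)
Definition is_pullback_ext (W Y : C) (g : hom W Y) (E : split_ext Y)
    (E' : split_ext W) :=
  exists p2 : hom (se_tot E') (se_tot E),
    is_pullback g (se_f E) (se_f E') p2 /\ p2 ∘ se_s E' = se_s E ∘ g.

Definition stably_strong (Y : C) (E : split_ext Y) :=
  forall (W : C) (g : hom W Y) (E' : split_ext W),
    is_pullback_ext g E E' -> strong E'.

Definition protomodular (Y : C) := forall E : split_ext Y, stably_strong E.

End CategoryTheory.

Section BialgebraMorphisms.
Variable K : fieldType.

Record bialg_hom (A B : bialgType K) := BialgHom {
  bialg_fun :> {lrmorphism A -> B};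
  bialg_comul : forall x, comul (bialg_fun x) = tmap bialg_fun bialg_fun (comul x);
  bialg_counit : forall x, counit (bialg_fun x) = counit x
}.

Lemma lrmorphism_ext (A B : algType K) (f g : {lrmorphism A -> B}) :
  f =1 g -> f = g.
Proof.
case: f g => [f cf] [g cg] /= /funext fg; move: cf cg; rewrite {}fg.
case=> [[n1] [m1] [s1]] [[n2] [m2] [s2]].
by rewrite (Prop_irrelevance n1 n2) (Prop_irrelevance m1 m2)
  (Prop_irrelevance s1 s2).
Qed.

Lemma bialg_hom_ext (A B : bialgType K) (f g : bialg_hom A B) :
  f =1 g -> f = g.
Proof.
case: f g => [f f1 f2] [g g1 g2] /= fg.
have efg := lrmorphism_ext fg; move: f1 f2 g1 g2; rewrite {}efg => *.
by congr BialgHom; exact: Prop_irrelevance.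
Qed.

Lemma tmap_id (V W : lmodType K) (x : V ⊗ W) : tmap idfun idfun x = x.
Proof.
elim/tensor_ind: x => [|v w x IHx]; first by rewrite linear0.
by rewrite linearD /= tmapE IHx.
Qed.

Lemma tmap_comp (V V' V'' W W' W'' : lmodType K)
    (f' : {linear V' -> V''}) (f : {linear V -> V'})
    (g' : {linear W' -> W''}) (g : {linear W -> W'}) (x : V ⊗ W) :
  tmap (f' \o f) (g' \o g) x = tmap f' g' (tmap f g x).
Proof.
elim/tensor_ind: x => [|v w x IHx]; first by rewrite !linear0.
by rewrite !linearD /= !tmapE IHx.
Qed.

Fact bialg_id_comul (A : bialgType K) (x : A) :
  comul (idfun x) = tmap idfun idfun (comul x).
Proof. by rewrite tmap_id. Qed.

Definition bialg_id (A : bialgType K) : bialg_hom A A :=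
  @BialgHom A A idfun (@bialg_id_comul A) (fun=> erefl).

Section Comp.
Variables (A B D : bialgType K) (g : bialg_hom B D) (f : bialg_hom A B).

Fact bialg_comp_comul x :
  comul ((g \o f) x) = tmap (g \o f) (g \o f) (comul x).
Proof. by rewrite /= !bialg_comul tmap_comp. Qed.

Fact bialg_comp_counit x : counit ((g \o f) x) = counit x.
Proof. by rewrite /= !bialg_counit. Qed.

Definition bialg_comp : bialg_hom A D :=
  @BialgHom A D (g \o f) bialg_comp_comul bialg_comp_counit.

End Comp.

Fact bialg_compA (A B D E : bialgType K) (h : bialg_hom D E)
    (g : bialg_hom B D) (f : bialg_hom A B) :
  bialg_comp h (bialg_comp g f) = bialg_comp (bialg_comp h g) f.
Proof. exact: bialg_hom_ext. Qed.

Fact bialg_comp1l (A B : bialgType K) (f : bialg_hom A B) :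
  bialg_comp (bialg_id B) f = f.
Proof. exact: bialg_hom_ext. Qed.

Fact bialg_comp1r (A B : bialgType K) (f : bialg_hom A B) :
  bialg_comp f (bialg_id A) = f.
Proof. exact: bialg_hom_ext. Qed.

Definition BiAlg_coc : category := {|
  obj := cocBialgType K;
  hom := fun A B => bialg_hom A B;
  cid := fun A => bialg_id A;
  ccomp := fun A B D g f => bialg_comp g f;
  ccompA := fun A B D E h g f => bialg_compA h g f;
  ccomp1l := fun A B f => bialg_comp1l f;
  ccomp1r := fun A B f => bialg_comp1r f
|}.

End BialgebraMorphisms.

Section ZeroObject.
Variable K : fieldType.

Definition base_comul (x : K^o) : K^o ⊗ K^o := tens x 1.

Fact base_comul_linear : linear base_comul.
Proof. by move=> c x y; rewrite /base_comul linearPl. Qed.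

HB.instance Definition _ :=
  GRing.isLinear.Build K K^o (K^o ⊗ K^o)%type *:%R base_comul base_comul_linear.

Lemma tens_base (V : lmodType K) (x : K^o) (v : V) :
  tens x v = (x : K) *: tens (1 : K^o) v.
Proof. by rewrite -linearZl_LR /= /GRing.scale /= mulr1. Qed.

Lemma tens_baser (V : lmodType K) (x : K^o) (v : V) :
  tens v x = (x : K) *: tens v (1 : K^o).
Proof. by rewrite -linearZr_LR /= /GRing.scale /= mulr1. Qed.

Fact base_comulA (x : K^o) :
  tassoc (tmap base_comul idfun (base_comul x)) =
  tmap idfun base_comul (base_comul x).
Proof. by rewrite !tmapE tassocE. Qed.

Fact base_counitl (x : K^o) : tmap idfun idfun (base_comul x) = tens (1 : K^o) x.
Proof. by rewrite tmap_id /base_comul tens_base -tens_baser. Qed.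

Fact base_counitr (x : K^o) : tmap idfun idfun (base_comul x) = tens x (1 : K^o).
Proof. by rewrite tmap_id. Qed.

HB.instance Definition _ := Lmodule_isCoalgebra.Build K K^o
  base_comulA base_counitl base_counitr.

Fact base_comulC (x : K^o) : tswap (comul x) = comul x.
Proof. by rewrite tswapE tens_baser -tens_base. Qed.

HB.instance Definition _ := Coalgebra_isCocommutative.Build K K^o base_comulC.

Fact base_comulM (x y : K^o) : comul (x * y) = comul x * comul y.
Proof. by rewrite tensM mulr1. Qed.

HB.instance Definition _ := Coalgebra_isBialgebra.Build K K^o
  erefl base_comulM erefl (fun _ _ => erefl).

Section Counit.
Variable A : cocBialgType K.

Definition base_counit (x : A) : K^o := counit x.

Fact base_counit_linear : linear base_counit.
Proof. exact: linearP. Qed.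

HB.instance Definition _ :=
  GRing.isLinear.Build K A K^o *:%R base_counit base_counit_linear.

HB.instance Definition _ := GRing.isMonoidMorphism.Build A K^o
  base_counit (counit1, @counitM K A).

Fact base_counit_comul (x : A) :
  comul (base_counit x) = tmap base_counit base_counit (comul x).
Proof.
transitivity (tmap idfun counit (tmap counit idfun (comul x))).
  by rewrite counitl tmapE /= [RHS]tens_baser -tens_base.
by rewrite -tmap_comp.
Qed.

Definition to_base : bialg_hom A K^o :=
  @BialgHom K A K^o base_counit base_counit_comul (fun=> erefl).

Definition base_unit (c : K^o) : A := (c : K) *: 1.

Fact base_unit_linear : linear base_unit.
Proof. by move=> c x y; rewrite /base_unit scalerDl scalerA. Qed.

HB.instance Definition _ :=
  GRing.isLinear.Build K K^o A *:%R base_unit base_unit_linear.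

Fact base_unit_monoid : monoid_morphism base_unit.
Proof.
split=> [|x y]; rewrite /base_unit ?scale1r //.
by rewrite -scalerAl mul1r scalerA.
Qed.

HB.instance Definition _ :=
  GRing.isMonoidMorphism.Build K^o A base_unit base_unit_monoid.

Fact base_unit_comul c :
  comul (base_unit c) = tmap base_unit base_unit (comul c).
Proof.
have e : (comul c : K^o ⊗ K^o) = (c : K) *: tens (1 : K^o) (1 : K^o).
  exact: tens_base.
rewrite [X in comul X]/base_unit linearZ /= comul1 e linearZ /=.
congr (_ *: _); transitivity (tens (base_unit 1) (base_unit 1)).
  by rewrite /base_unit scale1r.
by rewrite tmapE.
Qed.

Fact base_unit_counit c : counit (base_unit c) = counit c.
Proof. by rewrite linearZ /= counit1 /GRing.scale /= mulr1. Qed.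

Definition from_base : bialg_hom K^o A :=
  @BialgHom K K^o A base_unit base_unit_comul base_unit_counit.

End Counit.

Lemma base_is_zero_obj : @is_zero_obj (BiAlg_coc K) (K^o : cocBialgType K).
Proof.
move=> A; split.
  exists (from_base A); split=> // f _; apply: bialg_hom_ext => c /=.
  by rewrite -[c in RHS]mulr1 [RHS](linearZ_LR f) rmorph1.
exists (to_base A); split=> // f _; apply: bialg_hom_ext => x /=.
exact/esym/(bialg_counit f).
Qed.

End ZeroObject.

(* Main.v *)
From HB Require Import structures.
Require Import Defs.
From mathcomp Require Import all_boot all_algebra.
From mathcomp Require Import boolp.
From mathcomp Require classical_sets.

(* If Y has an antipode S, the formula x = (x s(f(x))^-1) s(f(x)) known from *)
(* groups makes sense in convolution algebras. On the pullback of a split    *)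
(* extension it yields a coalgebra map sigma that is a section of any        *)
(* monomorphism m through which the kernel and the section factor. The       *)
(* coalgebra maps sigma m and id agree after m, and a monomorphism of        *)
(* bialgebras is left cancellable even for coalgebra maps (by its kernel     *)
(* pair), so m is bijective.                                                 *)
(*   Conversely, a grouplike element g of Y defines a split extension whose  *)
(* total object is the analogue of the monoid Y + Y t Y with t over g. If it *)
(* is strong, t is a sum of elements a w b with w = alpha t beta and         *)
(* alpha g beta = 1. Since K is algebraically closed, such a sum lifts to    *)
(* equations a alpha = 1 = alpha g beta between grouplike elements, whence   *)
(* g (beta alpha) = 1. So all grouplikes are invertible; then the canonical  *)
(* map of Y is bijective, because its kernel and its cokernel would          *)
(* otherwise contain a weight vector for some grouplike element.             *)

Set Implicit Arguments.
Unset Strict Implicit.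
Unset Printing Implicit Defensive.

Import GRing.Theory.
Local Open Scope ring_scope.

(** From an antipode to protomodularity ([hopf_protomodular]): the group identity x = (x s(f(x))^-1)
    s(f(x)) becomes x = x_1 s(S(f(x_2))) s(f(x_3)). The factor x_1 s(S(f(x_2))) defines a coalgebra
    map, by [antipode_coalg] and cocommutativity, with values in the Hopf kernel of f
    ([equalizer_exists]). It need not be an algebra map, so the universal properties of pullbacks
    and monomorphisms of bialgebras are first extended to coalgebra maps by [jointly_monic_coalg].
    Protomodularity gives strong split extensions by pulling back along the identity
    ([protomodular_strong]). From strong split extensions to an antipode ([strong_hopf]), the field
    being algebraically closed: the dual of a cocommutative coalgebra acts by commuting operators,
    and a joint eigenvector has a grouplike element as its weight ([weight_vector]). If all
    grouplikes are invertible, weights exclude any kernel or cokernel of [can_map], and Y is Hopf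
    ([grouplike_invertible_hopf]). To invert a grouplike g, one takes the test extension [ext]. The
    Y ⊗ Y components of its kernel satisfy mid(w_1) ⊗ w_2 = 1 ⊗ w, and strongness puts 1 ⊗ 1 into
    the bimodule that such w span ([strong_extension_span]). Finally [grouplike_lift] turns this
    linear relation into equations between grouplikes, which are solved as in a monoid
    ([strong_grouplike_right_inverse]). *)

Section LinearAlgebra.
Variable K : fieldType.

(** * Linear algebra in arbitrary dimension: complements, functionals, finite rank *)

Definition subspace (V : lmodType K) (S : V -> Prop) :=
  S 0 /\ forall c x y, S x -> S y -> S (c *: x + y).

Definition mk_linear (V W : lmodType K) (f : V -> W) (lin : linear f) :
  {linear V -> W} := HB.pack f (GRing.isLinear.Build K V W *:%R f lin).

Section Subspace.
Variables (V : lmodType K) (S : V -> Prop).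
Hypothesis hS : subspace S.

Lemma subspace0 : S 0. Proof. exact: hS.1. Qed.

Lemma subspaceD x y : S x -> S y -> S (x + y).
Proof. by move=> Sx Sy; rewrite -[x]scale1r; apply: hS.2. Qed.

Lemma subspaceZ c x : S x -> S (c *: x).
Proof. by move=> Sx; rewrite -[_ *: _]addr0; apply: hS.2 => //; apply: hS.1. Qed.

Lemma subspaceB x y : S x -> S y -> S (x - y).
Proof.
by move=> Sx Sy; rewrite -scaleN1r; apply: subspaceD => //; apply: subspaceZ.
Qed.

Lemma subspace_sum (I : Type) (r : seq I) (P : pred I) (F : I -> V) :
  (forall i, P i -> S (F i)) -> S (\sum_(i <- r | P i) F i).
Proof. by move=> SF; apply: big_ind => //; [apply: subspace0|apply: subspaceD]. Qed.

End Subspace.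

Lemma subspace_zero (V : lmodType K) : subspace (fun v : V => v = 0).
Proof. by split=> // c x y -> ->; rewrite scaler0 addr0. Qed.

Lemma subspace_ker (V W : lmodType K) (f : {linear V -> W}) :
  subspace (fun v => f v = 0).
Proof. by split=> [|c x y fx fy]; rewrite ?linear0 // linearP fx fy scaler0 addr0. Qed.

(** Zorn's lemma with a bound demanded only for nonempty chains, since in the uses below the union
    of the empty chain is not a subspace. *)
Lemma maximal_exists (T : Type) (Q : (T -> Prop) -> Prop) (A0 : T -> Prop) :
    Q A0 ->
    (forall F : (T -> Prop) -> Prop, (exists A, F A) -> (forall A, F A -> Q A) ->
      (forall A B, F A -> F B ->
        (forall x, A x -> B x) \/ (forall x, B x -> A x)) ->
      Q (fun x => exists2 A, F A & A x)) ->
  exists A, Q A /\ forall B, Q B -> (forall x, A x -> B x) -> forall x, B x -> A x.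
Proof.
move=> QA0 Qchain.
(* The empty chain, whose union need not satisfy [Q], forces the disjunct. *)
pose P (A : T -> Prop) := A = (fun=> False) \/ Q A.
have [F FP Ftot|A [PA maxA]] := @classical_sets.Zorn_bigcup T P.
  have [[A [FA QA]]|noA] := pselect (exists A, F A /\ Q A); last first.
    left; apply/funext => x; apply/propext; split=> // -[A FA Ax].
    have [AF|QA] := FP _ FA; first by rewrite AF in Ax.
    by case: noA; exists A.
  right; suff -> : classical_sets.bigcup F id =
      (fun x => exists2 A, F A /\ Q A & A x).
    apply: Qchain => [|B []//|B C [FB _] [FC _]]; first by exists A.
    by case: (Ftot _ _ FB FC) => h; [left|right].
  apply/funext => x; apply/propext; split=> [[B FB Bx]|[B [FB _] Bx]].
    exists B => //; split=> //; have [BF|//] := FP _ FB.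
    by rewrite BF in Bx.
  by exists B.
have QA : Q A.
  case: PA => // A_0.
  have [[x A0x]|noA0] := pselect (exists x, A0 x).
    case: (maxA A0); last by right.
    by rewrite A_0; split=> [y []|h]; have := h _ A0x.
  suff -> : A = A0 by [].
  rewrite A_0; apply/funext => x; apply/propext; split=> // A0x.
  by case: noA0; exists x.
exists A; split=> // B QB AB x Bx.
have [//|nAx] := pselect (A x).
case: (maxA B); last by right.
by split=> // BA; apply/nAx/BA.
Qed.

Lemma chain_union_subspace (V : lmodType K) (F : (V -> Prop) -> Prop) :
  (exists A, F A) -> (forall A, F A -> subspace A) ->
  (forall A B, F A -> F B ->
    (forall x, A x -> B x) \/ (forall x, B x -> A x)) ->
  subspace (fun x => exists2 A, F A & A x).
Proof.
move=> [A FA] Fsub Ftot; split; first by exists A => //; apply: (Fsub A FA).1.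
move=> c x y [B FB Bx] [C FC Cy].
case: (Ftot _ _ FB FC) => [BC|CB].
  by exists C => //; apply: (Fsub C FC).2 => //; apply: BC.
by exists B => //; apply: (Fsub B FB).2 => //; apply: CB.
Qed.

(** A maximal subspace [T] that contains [H] and meets [S] in 0 is a complement of [S], because a
    vector outside S + T could be added to [T]. The projection is taken along [T]. *)
Lemma projection_exists (V : lmodType K) (S H : V -> Prop) :
  subspace S -> subspace H -> (forall x, S x -> H x -> x = 0) ->
  exists p : {linear V -> V},
    [/\ forall x, S (p x), forall x, S x -> p x = x & forall x, H x -> p x = 0].
Proof.
move=> sS sH SH0.
pose Q (T : V -> Prop) := [/\ subspace T, forall x, S x -> T x -> x = 0 &
  forall x, H x -> T x].
have [T [[sT ST0 HT] maxT]] : exists A, Q A /\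
    forall B, Q B -> (forall x, A x -> B x) -> forall x, B x -> A x.
  apply: (maximal_exists (A0 := H)) => // F [A FA] FQ Ftot; split.
  - by apply: chain_union_subspace => // [|B /FQ[]//]; exists A.
  - by move=> x Sx [B /FQ[_ SB0 _] Bx]; apply: SB0.
  - by move=> x Hx; exists A => //; have [_ _] := FQ _ FA; apply.
have dec v : exists s, S s /\ T (v - s).
  apply: contrapT => nv.
  have nvT : ~ T v by move=> Tv; apply: nv; exists 0; rewrite subr0; split => //; apply: sS.1.
  apply: nvT; apply: (maxT (fun x => exists c t, T t /\ x = c *: v + t)).
  - split=> [|x Sx [c [t [Tt xE]]]|x Hx].
    + split=> [|c _ _ [a [t [Tt ->]]] [b [u [Tu ->]]]].
        by exists 0, 0; rewrite scale0r addr0; split=> //; apply: sT.1.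
      exists (c * a + b), (c *: t + u); split; first exact: sT.2.
      by rewrite scalerDr scalerA addrACA scalerDl.
    + have [c0|c0] := eqVneq c 0.
        by apply: ST0 => //; rewrite xE c0 scale0r add0r.
      case: nv; exists (c^-1 *: x); split; first exact: subspaceZ.
      rewrite xE scalerDr scalerA mulVf // scale1r opprD addrA subrr add0r.
      by rewrite -scalerN; apply: (subspaceZ sT); rewrite -scaleN1r; apply: subspaceZ.
    + by exists 0, x; rewrite scale0r add0r; split=> //; apply: HT.
  - by move=> x Tx; exists 0, x; rewrite scale0r add0r.
  - by exists 1, 0; rewrite scale1r addr0; split=> //; apply: sT.1.
pose p v := sval (cid (dec v)).
have [Sp Tp] : (forall v, S (p v)) /\ (forall v, T (v - p v)).
  by split=> v; rewrite /p; case: cid => s /= [].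
have uniq v s : S s -> T (v - s) -> p v = s.
  move=> Ss Ts; apply/eqP; rewrite -subr_eq0; apply/eqP/ST0; first exact: subspaceB.
  have -> : p v - s = (v - s) - (v - p v) by rewrite opprB [RHS]addrC addrA subrK.
  exact: subspaceB.
have lin : linear p.
  move=> c x y; apply: uniq; first by apply: sS.2.
  by rewrite opprD addrACA -scalerBr; apply: sT.2.
exists (mk_linear lin); split=> [//|x Sx|x Hx] /=; apply: uniq => //.
- by rewrite subrr; apply: sT.1.
- exact: sS.1.
- by rewrite subr0; apply: HT.
Qed.

Lemma functional_exists (V : lmodType K) (H : V -> Prop) (v : V) :
  subspace H -> ~ H v ->
  exists phi : {linear V -> K^o}, phi v = 1 /\ forall x, H x -> phi x = 0.
Proof.
move=> sH nHv.
have v0 : v != 0 by apply/eqP => v0; apply: nHv; rewrite v0; apply: sH.1.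
have [||p [Sp pS pH]] := @projection_exists V (fun x => exists c, x = c *: v) H _ sH.
- split=> [|c _ _ [a ->] [b ->]]; first by exists 0; rewrite scale0r.
  by exists (c * a + b); rewrite scalerDl scalerA.
- move=> x [c ->] Hcv; have [->|c0] := eqVneq c 0; first by rewrite scale0r.
  by case: nHv; rewrite -[v]scale1r -(mulVf c0) -scalerA; apply: subspaceZ.
pose f x : K^o := sval (cid (Sp x)).
have fE x : p x = f x *: v by rewrite /f; case: cid.
have inj (a b : K) : a *: v = b *: v -> a = b.
  move=> /eqP; rewrite -subr_eq0 -scalerBl scaler_eq0 (negPf v0) orbF subr_eq0.
  by move=> /eqP.
have lin : linear f.
  by move=> c x y; apply: inj; rewrite -fE linearP !fE scalerDl scalerA.
exists (mk_linear lin); split=> [|x Hx] /=; apply: inj; rewrite -fE.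
  by rewrite scale1r pS //; exists 1; rewrite scale1r.
by rewrite scale0r pH.
Qed.

Lemma functional_sep (V : lmodType K) (x y : V) :
  (forall phi : {linear V -> K^o}, phi x = phi y) -> x = y.
Proof.
move=> h; apply/eqP; rewrite -subr_eq0; apply/eqP; apply: contrapT => nxy.
have [phi [phi1 _]] := functional_exists (subspace_zero V) nxy.
by move/eqP: phi1; rewrite linearB h subrr eq_sym oner_eq0.
Qed.

Section Contraction.
Variables (V W : lmodType K) (phi : {linear V -> K^o}).

Definition contr_pre (v : V) (w : W) : W := (phi v : K) *: w.

Fact contr_pre_bilinear : bilinear_for *:%R *:%R contr_pre.
Proof.
split=> [w|v] c x y; rewrite /contr_pre.
  by rewrite linearP scalerDl -[LHS]/((c * _) *: w + _) /= scalerA.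
by rewrite /= scalerDr !scalerA [_ * c]mulrC.
Qed.

HB.instance Definition _ := bilinear_isBilinear.Build K V W W _ _
  contr_pre contr_pre_bilinear.

(** The slice map phi ⊗ id, read through K ⊗ W = W. Many identities between tensors below are proved
    by comparing slices ([tensor_sep]). *)
Definition contr : V ⊗ W -> W := tlift contr_pre.
HB.instance Definition _ := GRing.Linear.on contr.

Lemma contrE v w : contr (tens v w) = (phi v : K) *: w.
Proof. exact: tliftE. Qed.

End Contraction.

Lemma eq_contr (V W : lmodType K) (phi psi : {linear V -> K^o}) (t : V ⊗ W) :
  phi =1 psi -> contr phi t = contr psi t.
Proof.
by move=> e; elim/tensor_ind: t => [|v w t IH]; rewrite ?linear0 // !linearD /= IH !contrE e.
Qed.

Lemma contr_tmap (V V' W W' : lmodType K) (f : {linear V -> V'})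
    (g : {linear W -> W'}) (phi : {linear V' -> K^o}) (t : V ⊗ W) :
  contr phi (tmap f g t) = g (contr (phi \o f) t).
Proof.
elim/tensor_ind: t => [|v w t IH]; first by rewrite !linear0.
by rewrite !linearD /= IH tmapE !contrE linearZ.
Qed.

(** A finite-rank operator P that fails to fix the next vector v is enlarged by the term f((1 - P)
    x) (v - P v) with f(v - P v) = 1. This term vanishes on what P already fixes. *)
Lemma finite_rank_fix (V : lmodType K) (s : seq V) :
  exists (n : nat) (e : 'I_n -> V) (phi : 'I_n -> {linear V -> K^o}),
    forall v, v \in s -> v = \sum_k (phi k v : K) *: e k.
Proof.
elim: s => [|v s [n [e [phi IH]]]].
  by exists 0%N, (fun=> 0), (fun=> \0); move=> ?; rewrite in_nil.
pose P (x : V) := \sum_k (phi k x : K) *: e k.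
have [Pv|/eqP nPv] := eqVneq v (P v).
  by exists n, e, phi => x /[!inE] /predU1P[->|/IH].
have PL : linear (fun x => x - P x).
  move=> c x y; rewrite scalerBr /P scaler_sumr addrACA -opprD -big_split /=.
  by congr (_ - _); apply: eq_bigr => k _; rewrite linearP scalerDl scalerA.
pose Q := mk_linear PL.
have [|f [f1 f0]] := @functional_exists V _ (v - P v) (subspace_zero V).
  by move=> /eqP; rewrite subr_eq0 => /eqP.
exists n.+1, (fun k => if unlift ord0 k is Some i then e i else v - P v),
  (fun k => if unlift ord0 k is Some i then phi i else (f \o Q : {linear V -> K^o})).
move=> x /[!inE] xs; rewrite big_ord_recl unlift_none /=.
under eq_bigr => k _ do rewrite liftK.
case/predU1P: xs => [->|xs]; first by rewrite f1 scale1r addrNK.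
have Px : x - P x = 0 by rewrite /P -IH // subrr.
by rewrite -[X in _ = X + _]/((f (x - P x) : K) *: _) Px linear0 scale0r add0r -IH.
Qed.

(** One finite-rank operator fixes [v] and all first legs of a representative of [t]. Sharing the
    family allows [t] and [v] to be expanded side by side. *)
Lemma tensor_finite_rank (V W : lmodType K) (t : V ⊗ W) (v : V) :
  exists (n : nat) (e : 'I_n -> V) (phi : 'I_n -> {linear V -> K^o}),
    t = \sum_k tens (e k) (contr (phi k) t) /\ v = \sum_k (phi k v : K) *: e k.
Proof.
elim/(@tensor_piW K V W): t => s; rewrite pi_tensorE.
have [n [e [phi h]]] := finite_rank_fix (v :: unzip1 s).
exists n, e, phi; split; last by rewrite -h ?mem_head.
rewrite -[LHS]/(\sum_(p <- s) tens p.1 p.2).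
under [RHS]eq_bigr => k _ do rewrite linear_sum linear_sumr /=.
rewrite exchange_big /= big_seq [RHS]big_seq; apply: eq_bigr => p ps.
rewrite {1}(h p.1) ?in_cons ?map_f ?orbT // linear_sumlz /=.
by apply: eq_bigr => k _; rewrite contrE linearZl_LR linearZr_LR.
Qed.

Lemma tensor_sep (V W : lmodType K) (t u : V ⊗ W) :
  (forall (phi : {linear V -> K^o}) (psi : {linear W -> K^o}),
    psi (contr phi t) = psi (contr phi u)) -> t = u.
Proof.
move=> h; apply/eqP; rewrite -subr_eq0; apply/eqP.
have [n [e [phi [-> _]]]] := tensor_finite_rank (t - u) 0.
apply: big1 => k _; suff -> : contr (phi k) (t - u) = 0 by rewrite linear0r.
by rewrite linearB; apply/eqP; rewrite subr_eq0; apply/eqP/functional_sep => psi; exact: h.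
Qed.

Lemma linear_lift (U V W : lmodType K) (i : {linear V -> W}) (u : {linear U -> W}) :
  injective i -> (forall x, exists v, i v = u x) ->
  exists u' : {linear U -> V}, forall x, i (u' x) = u x.
Proof.
move=> inj h; pose f x := sval (cid (h x)).
have fE x : i (f x) = u x by rewrite /f; case: cid.
have lin : linear f by move=> c x y; apply: inj; rewrite linearP !fE linearP.
by exists (mk_linear lin).
Qed.

Lemma linear_retraction (V W : lmodType K) (i : {linear V -> W}) :
  injective i -> exists r : {linear W -> V}, cancel i r.
Proof.
move=> inj.
have [|//|p [Sp pS _]] := @projection_exists W (fun w => exists v, i v = w)
  (fun w => w = 0) _ (subspace_zero W).
  split=> [|c _ _ [x <-] [y <-]]; first by exists 0; rewrite linear0.
  by exists (c *: x + y); rewrite linearP.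
have [r rE] := linear_lift inj Sp.
by exists r => v; apply: inj; rewrite rE pS //; exists v.
Qed.

Lemma tmap_inj (V V' W W' : lmodType K) (f : {linear V -> V'})
    (g : {linear W -> W'}) : injective f -> injective g -> injective (tmap f g).
Proof.
move=> /linear_retraction[r fK] /linear_retraction[q gK].
apply: (can_inj (g := tmap r q)) => t.
elim/tensor_ind: t => [|v w t IH]; first by rewrite !linear0.
by rewrite !linearD /= IH !tmapE fK gK.
Qed.

Lemma eq_tmap (V V' W W' : lmodType K) (f f' : {linear V -> V'})
    (g g' : {linear W -> W'}) : f =1 f' -> g =1 g' -> tmap f g =1 tmap f' g'.
Proof.
move=> ef eg t; elim/tensor_ind: t => [|v w t IH]; first by rewrite !linear0.
by rewrite !linearD /= IH !tmapE ef eg.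
Qed.

End LinearAlgebra.

(** * Slices of iterated tensor products *)

Section Contractions.
Variable K : fieldType.

Lemma contr_assoc (U V W : lmodType K) (phi : {linear U -> K^o})
    (psi : {linear V -> K^o}) (t : (U ⊗ V) ⊗ W) :
  contr psi (contr phi (tassoc t)) = contr (psi \o contr phi) t.
Proof.
elim/tensor_ind: t => [|s w t IH]; first by rewrite !linear0.
rewrite !linearD /= {}IH; congr (_ + _).
elim/tensor_ind: s => [|u v s IH]; first by rewrite linear0l !linear0.
rewrite linearDl !linearD /= {}IH; congr (_ + _).
by rewrite tassocE !contrE linearZ /= !contrE linearZ /= scalerA [psi (_ *: _)]linearZ mulrC.
Qed.

Lemma tassoc_tmap (U U' V V' W W' : lmodType K) (f : {linear U -> U'})
    (g : {linear V -> V'}) (h : {linear W -> W'}) (t : (U ⊗ V) ⊗ W) :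
  tassoc (tmap (tmap f g) h t) = tmap f (tmap g h) (tassoc t).
Proof.
elim/tensor_ind: t => [|s w t IH]; first by rewrite !linear0.
rewrite !linearD /= {}IH; congr (_ + _).
elim/tensor_ind: s => [|u v s IH]; first by rewrite linear0l !linear0.
rewrite linearDl !linearD /= {}IH; congr (_ + _).
by rewrite tassocE !tmapE /= !tmapE tassocE.
Qed.

Lemma contr_swap (V W : lmodType K) (phi : {linear V -> K^o})
    (psi : {linear W -> K^o}) (t : V ⊗ W) :
  phi (contr psi (tswap t)) = psi (contr phi t).
Proof.
elim/tensor_ind: t => [|v w t IH]; first by rewrite !linear0.
by rewrite !linearD /= IH tswapE !contrE !linearZ /= [X in X + _]mulrC.
Qed.

Lemma tswapK (V W : lmodType K) : cancel (@tswap K V W) (@tswap K W V).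
Proof.
elim/tensor_ind=> [|v w t IH]; first by rewrite !linear0.
by rewrite !linearD /= IH !tswapE.
Qed.

Lemma tensor_sepl (U V W : lmodType K) (t u : (U ⊗ V) ⊗ W) :
  (forall (phi : {linear U -> K^o}) (psi : {linear V -> K^o}),
     contr (psi \o contr phi) t = contr (psi \o contr phi) u) -> t = u.
Proof.
move=> h; apply: (can_inj (@tswapK _ _)); apply: tensor_sep => chi psi.
congr (psi _); apply: tensor_sep => phi1 phi2.
by rewrite -![phi2 (contr phi1 _)]/((phi2 \o contr phi1) _) !contr_swap h.
Qed.

Lemma contr_idl (V : lmodType K) (t : K^o ⊗ V) : t = tens (1 : K^o) (contr idfun t).
Proof.
elim/tensor_ind: t => [|v w t IH]; first by rewrite linear0 linear0r.
by rewrite linearD linearDr /= -IH contrE linearZr_LR tens_base.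
Qed.

HB.instance Definition _ (V W : lmodType K) (v : V) :=
  GRing.isLinear.Build K W (V ⊗ W)%type *:%R (@tens K V W v)
    (linearPr (@tens K V W) v).

Section Middle.
Variables (C C' D D' : lmodType K).

Definition tmid_in (t : D ⊗ D') (c : C) (c' : C') : (C ⊗ D) ⊗ (C' ⊗ D') :=
  tmap (tens c) (tens c') t.

Fact tmid_in_bilinear t : bilinear_for *:%R *:%R (tmid_in t).
Proof.
split=> [c'|c] a x y; rewrite /tmid_in /=; elim/tensor_ind: t => [|d d' t IH];
  rewrite ?linear0 ?scaler0 ?addr0 // !linearD /= {}IH !tmapE /=.
  by rewrite linearPl /= linearPl addrACA.
by rewrite linearPl /= linearPr addrACA.
Qed.

HB.instance Definition _ t := bilinear_isBilinear.Build K C C'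
  ((C ⊗ D) ⊗ (C' ⊗ D'))%type _ _ (tmid_in t) (tmid_in_bilinear t).

Definition tmid_pre (s : C ⊗ C') (t : D ⊗ D') := tlift (tmid_in t) s.

Fact tmid_pre_bilinear : bilinear_for *:%R *:%R tmid_pre.
Proof.
split=> [t|s] a x y; rewrite /tmid_pre; first by rewrite linearP.
elim/tensor_ind: s => [|c c' s IH]; first by rewrite !linear0 /= scaler0 addr0.
rewrite !linearD /= {}IH !tliftE /= scalerDr addrACA; congr (_ + _).
by rewrite /tmid_in linearP.
Qed.

HB.instance Definition _ := bilinear_isBilinear.Build K (C ⊗ C')%type
  (D ⊗ D')%type ((C ⊗ D) ⊗ (C' ⊗ D'))%type _ _ tmid_pre tmid_pre_bilinear.

Definition tmid : (C ⊗ C') ⊗ (D ⊗ D') -> (C ⊗ D) ⊗ (C' ⊗ D') := tlift tmid_pre.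
HB.instance Definition _ := GRing.Linear.on tmid.

Lemma tmidE c c' d d' :
  tmid (tens (tens c c') (tens d d')) = tens (tens c d) (tens c' d').
Proof. by rewrite /tmid tliftE /= /tmid_pre tliftE /= /tmid_in tmapE. Qed.

Lemma contr_tmid (phi : {linear C -> K^o}) (psi : {linear D -> K^o}) s t :
  contr (psi \o contr phi) (tmid (tens s t)) = tens (contr phi s) (contr psi t).
Proof.
elim/tensor_ind: s => [|c c' s IH].
  by rewrite linear0l !linear0 linear0l.
rewrite linearDl !linearD linearDl /= {}IH; congr (_ + _).
elim/tensor_ind: t => [|d d' t IH]; first by rewrite !linear0.
rewrite !linearD /= {}IH; congr (_ + _).
rewrite tmidE !contrE /= !contrE !linearZ /= linearZl_LR /=.
by rewrite scalerA mulrC.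
Qed.

End Middle.
End Contractions.

(** * The action of functionals on a coalgebra, and coalgebra maps *)

Section Action.
Variable K : fieldType.

(** The action x |-> phi(x_1) x_2 of the dual algebra. Subcoalgebras appear below as subspaces
    stable under it, and coalgebra maps as counital linear maps compatible with it
    ([coalg_mapP]). *)
Definition act (C : coalgType K) (phi : {linear C -> K^o}) (x : C) : C :=
  contr phi (comul x).

HB.instance Definition _ (C : coalgType K) (phi : {linear C -> K^o}) :=
  GRing.Linear.copy (act phi) (contr phi \o comul).

Variable C : coalgType K.
Implicit Types (x : C) (phi psi : {linear C -> K^o}).

Lemma eq_act phi psi x : phi =1 psi -> act phi x = act psi x.
Proof. exact: eq_contr. Qed.

Lemma act_act phi psi x : act psi (act phi x) = act (psi \o act phi) x.
Proof.
rewrite /act -[contr phi (comul x)]/(contr (phi \o idfun) (comul x)).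
rewrite -contr_tmap -comulA contr_assoc contr_tmap /=.
exact: eq_contr.
Qed.

Lemma act_counit x : act counit x = x.
Proof.
transitivity (contr idfun (tmap counit idfun (comul x))).
  by rewrite contr_tmap; apply: eq_contr.
by rewrite counitl contrE scale1r.
Qed.

Lemma act_scale_counit phi (c : K) x :
  (forall y, phi y = c * (counit y : K)) -> act phi x = c *: x.
Proof.
move=> e; rewrite -[in RHS](act_counit x) /act.
elim/tensor_ind: (comul x) => [|u v t IH]; first by rewrite !linear0.
by rewrite !linearD /= IH !contrE e scalerA.
Qed.

Lemma counit_act phi x : counit (act phi x) = phi x.
Proof.
transitivity (contr phi (tmap idfun counit (comul x))).
  by rewrite contr_tmap; congr (counit _); apply: eq_contr.
by rewrite counitr contrE /GRing.scale /= mulr1.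
Qed.

End Action.

Section CocommutativeAction.
Variables (K : fieldType) (C : cocCoalgType K).
Implicit Types (x : C) (phi psi : {linear C -> K^o}).

Lemma act_swap phi psi x : psi (act phi x) = phi (act psi x).
Proof. by rewrite /act -{1}[comul x]comulC contr_swap. Qed.

Lemma act_comm phi psi x : act phi (act psi x) = act psi (act phi x).
Proof. by rewrite !act_act; apply: eq_act => y; apply: act_swap. Qed.

End CocommutativeAction.

Section CoalgebraMaps.
Variable K : fieldType.

Definition coalg_map (C D : coalgType K) (f : {linear C -> D}) :=
  (forall x, comul (f x) = tmap f f (comul x)) /\
  (forall x, counit (f x) = counit x).

Lemma coalg_map_act (C D : coalgType K) (f : {linear C -> D}) phi x :
  coalg_map f -> act phi (f x) = f (act (phi \o f) x).
Proof. by case=> fD _; rewrite /act fD contr_tmap. Qed.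

Lemma coalg_mapP (C D : coalgType K) (f : {linear C -> D}) :
  (forall phi x, act phi (f x) = f (act (phi \o f) x)) ->
  (forall x, counit (f x) = counit x) -> coalg_map f.
Proof.
move=> fA fe; split=> // x; apply: tensor_sep => phi psi.
by rewrite contr_tmap -[contr phi _]/(act phi _) fA.
Qed.

Lemma coalg_map_id (C : coalgType K) : coalg_map (idfun : {linear C -> C}).
Proof. by split=> // x; rewrite tmap_id. Qed.

Lemma coalg_map_comp (C D E : coalgType K) (g : {linear D -> E})
    (f : {linear C -> D}) : coalg_map g -> coalg_map f -> coalg_map (g \o f).
Proof.
case=> gD ge [fD fe]; split=> x /=; last by rewrite ge.
by rewrite gD fD tmap_comp.
Qed.

Lemma bialg_hom_coalg (A B : bialgType K) (f : bialg_hom A B) : coalg_map f.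
Proof. by split; [apply: bialg_comul|apply: bialg_counit]. Qed.

Lemma eq_coalg_map (C D : coalgType K) (f g : {linear C -> D}) :
  f =1 g -> coalg_map f -> coalg_map g.
Proof.
move=> fg [fD fe]; split=> x; rewrite -fg // fD; exact: eq_tmap.
Qed.

End CoalgebraMaps.

(** * Tensor products of cocommutative coalgebras *)

Section TensorCoalgebra.
Variables (K : fieldType) (C D : cocCoalgType K).

Definition tcomul : C ⊗ D -> (C ⊗ D) ⊗ (C ⊗ D) := @tmid K C C D D \o tmap comul comul.
HB.instance Definition _ := GRing.Linear.on tcomul.

Definition tcounit : C ⊗ D -> K^o := counit \o contr counit.
HB.instance Definition _ := GRing.Linear.on tcounit.

Lemma tcounitE c d : tcounit (tens c d) = (counit c : K) * (counit d : K).
Proof. by rewrite /tcounit /= contrE linearZ. Qed.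

(** Slicing off the first copy of C ⊗ D leaves the two actions side by side. Through this formula
    the coalgebra axioms of C ⊗ D reduce to facts about [act] on each factor. *)
Lemma contr_tcomul (phi : {linear C -> K^o}) (psi : {linear D -> K^o}) t :
  contr (psi \o contr phi) (tcomul t) = tmap (act phi) (act psi) t.
Proof.
elim/tensor_ind: t => [|c d t IH]; first by rewrite !linear0.
rewrite !linearD /= {}IH; congr (_ + _).
by rewrite /tcomul /= !tmapE contr_tmid.
Qed.

Fact tcomulC t : tswap (tcomul t) = tcomul t.
Proof.
apply: tensor_sepl => phi psi; rewrite contr_tcomul.
apply: tensor_sep => phi' psi'.
rewrite -[_ (contr phi' _)]/((psi' \o contr phi') _) contr_swap contr_tcomul.
rewrite /= !contr_tmap.
elim/tensor_ind: t => [|c d t IH]; first by rewrite !linear0.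
rewrite !linearD /= {}IH; congr (_ + _).
by rewrite !contrE !linearZ /= act_swap; congr (_ * _); apply: act_swap.
Qed.

Fact tcounitl t : tmap tcounit idfun (tcomul t) = tens (1 : K^o) t.
Proof.
rewrite [LHS]contr_idl; congr tens; rewrite contr_tmap /=.
transitivity (contr (counit \o contr counit) (tcomul t)); first exact: eq_contr.
rewrite contr_tcomul -[RHS]tmap_id; apply: eq_tmap => x; exact: act_counit.
Qed.

Fact tcounitr t : tmap idfun tcounit (tcomul t) = tens t (1 : K^o).
Proof.
rewrite -(tcomulC t) -[RHS]tswapE -tcounitl.
elim/tensor_ind: (tcomul t) => [|c d u IH]; first by rewrite !linear0.
by rewrite !linearD /= IH !tswapE !tmapE tswapE.
Qed.

Fact tcomulA t :
  tassoc (tmap tcomul idfun (tcomul t)) = tmap idfun tcomul (tcomul t).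
Proof.
apply: tensor_sepl => phi phi'; apply: tensor_sepl => psi psi'.
rewrite contr_assoc !contr_tmap /=.
rewrite -[RHS]/(contr (psi' \o contr psi) (tcomul (contr (phi' \o contr phi) _))).
rewrite !contr_tcomul -tmap_comp /=.
transitivity (contr ((psi' \o act phi') \o contr (psi \o act phi)) (tcomul t)).
  apply: eq_contr => u /=.
  rewrite -[LHS]/((psi' \o contr psi) (contr (phi' \o contr phi) (tcomul u))).
  by rewrite contr_tcomul /= contr_tmap.
by rewrite contr_tcomul; apply: eq_tmap => x /=; rewrite act_act.
Qed.

HB.instance Definition _ := Lmodule_isCoalgebra.Build K (C ⊗ D)%type
  tcomulA tcounitl tcounitr.
HB.instance Definition _ := Coalgebra_isCocommutative.Build K (C ⊗ D)%type tcomulC.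

Lemma comul_tens c d : comul (tens c d) = tmid (tens (comul c) (comul d)).
Proof. by rewrite -[LHS]/(tcomul _) /tcomul /= tmapE. Qed.

Lemma act_tens (phi : {linear C -> K^o}) (psi : {linear D -> K^o}) t :
  act (psi \o contr phi) t = tmap (act phi) (act psi) t.
Proof. exact: contr_tcomul. Qed.

Definition tproj1 : C ⊗ D -> C := contr counit \o @tswap K C D.
HB.instance Definition _ := GRing.Linear.on tproj1.

Definition tproj2 : C ⊗ D -> D := contr counit.
HB.instance Definition _ := GRing.Linear.on tproj2.

Lemma tproj1E c d : tproj1 (tens c d) = (counit d : K) *: c.
Proof. by rewrite /tproj1 /= tswapE contrE. Qed.

Lemma tproj2E c d : tproj2 (tens c d) = (counit c : K) *: d.
Proof. exact: contrE. Qed.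

Lemma act_tproj1 (phi : {linear C -> K^o}) t :
  act (phi \o tproj1) t = tmap (act phi) idfun t.
Proof.
transitivity (act (counit \o contr phi) t).
  apply: eq_act => u; elim/tensor_ind: u => [|c d u IH]; first by rewrite !linear0.
  rewrite !linearD IH /=; congr (_ + _).
  by rewrite tproj1E contrE !linearZ /= [LHS]mulrC.
by rewrite act_tens; apply: eq_tmap => // x; apply: act_counit.
Qed.

Lemma act_tproj2 (psi : {linear D -> K^o}) t :
  act (psi \o tproj2) t = tmap idfun (act psi) t.
Proof. by rewrite act_tens; apply: eq_tmap => // x; apply: act_counit. Qed.

Lemma tproj1_coalg : coalg_map tproj1.
Proof.
apply: coalg_mapP => [phi|] t; elim/tensor_ind: t => [|c d t IH].
- by rewrite !linear0.
- rewrite !linearD /= IH; congr (_ + _).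
  by rewrite act_tproj1 tmapE !tproj1E linearZ.
- by rewrite !linear0.
- by rewrite !linearD /= IH tproj1E linearZ /= [counit (tens c d)]tcounitE mulrC.
Qed.

Lemma tproj2_coalg : coalg_map tproj2.
Proof.
apply: coalg_mapP => [phi|] t; elim/tensor_ind: t => [|c d t IH].
- by rewrite !linear0.
- rewrite !linearD /= IH; congr (_ + _).
  by rewrite act_tproj2 tmapE !tproj2E linearZ.
- by rewrite !linear0.
- by rewrite !linearD /= IH tproj2E linearZ /= [counit (tens c d)]tcounitE.
Qed.

End TensorCoalgebra.

Section TensorCoalgebraMaps.
Variable K : fieldType.

Lemma tmap_coalg (C C' D D' : cocCoalgType K) (f : {linear C -> C'})
    (g : {linear D -> D'}) : coalg_map f -> coalg_map g -> coalg_map (tmap f g).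
Proof.
move=> cf cg; split=> t.
  apply: tensor_sepl => phi psi.
  rewrite [LHS]act_tens contr_tmap -!tmap_comp.
  transitivity (tmap f g (contr ((psi \o g) \o contr (phi \o f)) (comul t))).
    rewrite [contr _ _]act_tens -tmap_comp.
    by apply: eq_tmap => x /=; rewrite coalg_map_act.
  by congr (tmap f g _); apply: eq_contr => u /=; rewrite contr_tmap.
elim/tensor_ind: t => [|c d t IH]; first by rewrite !linear0.
by rewrite !linearD /= IH tmapE ![counit (tens _ _)]tcounitE cf.2 cg.2.
Qed.

(** Cocommutativity is essential: the two sides differ by an exchange of the middle legs of x_1 ⊗
    x_2 ⊗ x_3 ⊗ x_4, which is [act_comm] after slicing. *)
Lemma comul_coalg (C : cocCoalgType K) : coalg_map (comul : {linear C -> (C ⊗ C)%type}).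
Proof.
split=> x.
  apply: tensor_sepl => phi psi; rewrite [LHS]act_tens contr_tmap.
  apply: tensor_sep => alpha beta; rewrite contr_tmap.
  have -> : contr ((psi \o contr phi) \o comul) (comul x) = act psi (act phi x).
    by rewrite act_act; apply: eq_contr.
  rewrite -[contr (alpha \o act phi) (comul x)]/(act _ x) -act_act.
  exact: congr1 (act_comm _ _ _).
rewrite -[LHS]/(counit (act counit x)) act_counit //.
Qed.

End TensorCoalgebraMaps.

Section Grouplike.
Variable K : fieldType.

Definition grouplike (C : coalgType K) (g : C) :=
  comul g = tens g g /\ counit g = 1.

Lemma grouplike_act (C : coalgType K) (g : C) phi :
  grouplike g -> act phi g = (phi g : K) *: g.
Proof. by case=> gg _; rewrite /act gg contrE. Qed.

Lemma grouplike_map (C D : coalgType K) (f : {linear C -> D}) g :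
  coalg_map f -> grouplike g -> grouplike (f g).
Proof. by move=> [fD fe] [gg g1]; split; rewrite ?fD ?fe // gg tmapE. Qed.

End Grouplike.

(** * Tensor products of algebras and bialgebras *)

Section TensorAlgebraInstance.
Variables (K : fieldType) (A B : algType K).

Fact tensor_oner_neq0 : (1 : (A ⊗ B)%type) != 0.
Proof.
apply/eqP => e.
have [|phi [phi1 _]] := functional_exists (subspace_zero A) (v := 1).
  by apply/eqP/oner_neq0.
have /eqP := congr1 (contr phi) e.
by rewrite -tens1 contrE linear0 phi1 scale1r oner_eq0.
Qed.

HB.instance Definition _ :=
  GRing.PzSemiRing_isNonZero.Build (A ⊗ B)%type tensor_oner_neq0.

Fact tensor_scalerAl (c : K) (x y : (A ⊗ B)%type) : c *: (x * y) = c *: x * y.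
Proof.
elim/tensor_ind: x => [|a b x IH]; first by rewrite mul0r !scaler0 mul0r.
rewrite mulrDl !scalerDr mulrDl {}IH; congr (_ + _).
elim/tensor_ind: y => [|a' b' y IH]; first by rewrite !mulr0 scaler0.
rewrite !mulrDr scalerDr {}IH; congr (_ + _).
by rewrite tensM -!linearZl_LR tensM /= scalerAl.
Qed.

HB.instance Definition _ :=
  GRing.Lmodule_isLalgebra.Build K (A ⊗ B)%type tensor_scalerAl.

Fact tensor_scalerAr (c : K) (x y : (A ⊗ B)%type) : c *: (x * y) = x * (c *: y).
Proof.
elim/tensor_ind: x => [|a b x IH]; first by rewrite !mul0r scaler0.
rewrite !mulrDl !scalerDr {}IH; congr (_ + _).
elim/tensor_ind: y => [|a' b' y IH]; first by rewrite mulr0 !scaler0 mulr0.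
rewrite !(mulrDr, scalerDr) {}IH; congr (_ + _).
by rewrite tensM -!linearZl_LR tensM /= scalerAr.
Qed.

HB.instance Definition _ :=
  GRing.Lalgebra_isAlgebra.Build K (A ⊗ B)%type tensor_scalerAr.

End TensorAlgebraInstance.

Section TensorBialgebra.
Variable K : fieldType.

(** A multiplication rule between two summands lifts to the products of their comultiplications. It
    serves for the multiplicativity of [ext_comul]. *)
Lemma tmap_mul (A B : algType K) (A1 A2 : lmodType K)
    (h1 : {linear A1 -> A}) (h2 : {linear A2 -> A})
    (h : {linear B -> A}) (h3 : {linear A1 -> B}) (h4 : {linear A2 -> B}) s t :
  (forall x y, h1 x * h2 y = h (h3 x * h4 y)) ->
  tmap h1 h1 s * tmap h2 h2 t = tmap h h (tmap h3 h3 s * tmap h4 h4 t).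
Proof.
move=> e; elim/tensor_ind: s => [|a b s IH]; first by rewrite !(linear0, mul0r).
rewrite !linearD !mulrDl linearD /= {}IH; congr (_ + _).
elim/tensor_ind: t => [|a' b' t IH]; first by rewrite !(linear0, mulr0).
rewrite !linearD !mulrDr linearD /= {}IH; congr (_ + _).
by rewrite !tmapE !tensM !tmapE !e.
Qed.

Lemma tmapM (A A' B B' : algType K) (f : {linear A -> A'})
    (g : {linear B -> B'}) (s t : (A ⊗ B)%type) :
  {morph f : x y / x * y} -> {morph g : x y / x * y} ->
  tmap f g (s * t) = tmap f g s * tmap f g t.
Proof.
move=> fM gM.
elim/tensor_ind: s => [|a b s IH]; first by rewrite !(linear0, mul0r).
rewrite mulrDl !linearD mulrDl /= {}IH; congr (_ + _).
elim/tensor_ind: t => [|a' b' t IH]; first by rewrite !(linear0, mulr0).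
rewrite mulrDr !linearD mulrDr /= {}IH; congr (_ + _).
by rewrite tensM !tmapE tensM fM gM.
Qed.

Lemma tmidM (A A' B B' : algType K) (s t : ((A ⊗ A') ⊗ (B ⊗ B'))%type) :
  tmid (s * t) = tmid s * tmid t.
Proof.
elim/tensor_ind: s => [|a b s IH]; first by rewrite !(linear0, mul0r).
rewrite mulrDl !linearD mulrDl /= {}IH; congr (_ + _).
elim/tensor_ind: t => [|a' b' t IH]; first by rewrite !(linear0, mulr0).
rewrite mulrDr !linearD mulrDr /= {}IH; congr (_ + _).
rewrite tensM.
elim/tensor_ind: a => [|a1 a2 a IH]; first by rewrite mul0r !linear0l !linear0 mul0r.
rewrite mulrDl !linearDl !linearD mulrDl /= {}IH; congr (_ + _).
elim/tensor_ind: b => [|b1 b2 b IH]; first by rewrite mul0r !linear0 mul0r.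
rewrite mulrDl !linearD mulrDl /= {}IH; congr (_ + _).
elim/tensor_ind: a' => [|a1' a2' a' IH]; first by rewrite mulr0 !linear0l !linear0 mulr0.
rewrite mulrDr !linearDl !linearD mulrDr /= {}IH; congr (_ + _).
elim/tensor_ind: b' => [|b1' b2' b' IH]; first by rewrite mulr0 !linear0 mulr0.
rewrite mulrDr !linearD mulrDr /= {}IH; congr (_ + _).
by rewrite !tensM !tmidE !tensM.
Qed.

Variables A B : cocBialgType K.

Fact tcomul1 : comul (1 : (A ⊗ B)%type) = 1.
Proof.
rewrite -[LHS]/(tcomul _) /tcomul /= -tens1 tmapE !comul1.
by rewrite -!tens1 tmidE.
Qed.

Fact tcomulM (x y : (A ⊗ B)%type) : comul (x * y) = comul x * comul y.
Proof. by rewrite -![comul _]/(tcomul _) /tcomul /= tmapM ?tmidM //; apply: comulM. Qed.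

Fact tcounit1 : counit (1 : (A ⊗ B)%type) = 1.
Proof. by rewrite -[LHS]/(tcounit _) -tens1 tcounitE !counit1 mulr1. Qed.

Fact tcounitM (x y : (A ⊗ B)%type) : counit (x * y) = counit x * counit y.
Proof.
elim/tensor_ind: x => [|a b x IH]; first by rewrite !(linear0, mul0r).
rewrite mulrDl !linearD mulrDl /= {}IH; congr (_ + _).
elim/tensor_ind: y => [|a' b' y IH]; first by rewrite !(linear0, mulr0).
rewrite mulrDr !linearD mulrDr /= {}IH; congr (_ + _).
rewrite tensM -![counit (tens _ _)]/(tcounit _) !tcounitE !counitM.
exact: mulrACA.
Qed.

HB.instance Definition _ := Coalgebra_isBialgebra.Build K (A ⊗ B)%type
  tcomul1 tcomulM tcounit1 tcounitM.

End TensorBialgebra.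

(** * Convolution algebras *)

Section Convolution.
Variable K : fieldType.

Section Conv.
Variables (C : coalgType K) (A : algType K).

Definition conv (u v : {linear C -> A}) : C -> A :=
  @tmult K A \o (tmap u v \o comul).
HB.instance Definition _ u v := GRing.Linear.on (conv u v).

Definition conv_unit (x : C) : A := (counit x : K) *: 1.

Fact conv_unit_linear : linear conv_unit.
Proof. by move=> c x y; rewrite /conv_unit linearP scalerDl scalerA. Qed.

HB.instance Definition _ :=
  GRing.isLinear.Build K C A *:%R conv_unit conv_unit_linear.

Lemma eq_conv (u u' v v' : {linear C -> A}) :
  u =1 u' -> v =1 v' -> conv u v =1 conv u' v'.
Proof. by move=> eu ev x; rewrite /conv /= (eq_tmap eu ev). Qed.

Lemma conv1l (u v : {linear C -> A}) : u =1 conv_unit -> conv u v =1 v.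
Proof.
move=> eu x; rewrite -[in RHS](act_counit x) /conv /act /=.
elim/tensor_ind: (comul x) => [|a b t IH]; first by rewrite !linear0.
rewrite !linearD /= {}IH tmapE tmultE eu contrE linearZ /=.
by rewrite /conv_unit -scalerAl mul1r.
Qed.

Lemma convA (u v w : {linear C -> A}) :
  conv (conv u v) w =1 conv u (conv v w).
Proof.
move=> x; rewrite /conv /=.
have e (t : ((C ⊗ C) ⊗ C)%type) :
    tmult (tmap (@tmult K A \o tmap u v) w t) =
    tmult (tmap u (@tmult K A \o tmap v w) (tassoc t)).
  elim/tensor_ind: t => [|s c t IH]; first by rewrite !linear0.
  rewrite !linearD /= {}IH; congr (_ + _).
  elim/tensor_ind: s => [|a b s IH]; first by rewrite linear0l !linear0.
  rewrite linearDl !linearD /= {}IH; congr (_ + _).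
  by rewrite tassocE !tmapE !tmultE /= !tmapE !tmultE mulrA.
transitivity (tmult (tmap (@tmult K A \o tmap u v) w
    (tmap comul idfun (comul x)))).
  by rewrite -tmap_comp.
by rewrite e comulA -tmap_comp.
Qed.

End Conv.

Lemma conv1r (C : cocCoalgType K) (A : algType K) (u v : {linear C -> A}) :
  v =1 @conv_unit C A -> conv u v =1 u.
Proof.
move=> ev x; rewrite -[in RHS](act_counit x) /conv /act /= -[in LHS](comulC x).
elim/tensor_ind: (comul x) => [|a b t IH]; first by rewrite !linear0.
rewrite !linearD /= {}IH tswapE tmapE tmultE ev contrE linearZ /=.
by rewrite /conv_unit -scalerAr mulr1.
Qed.

Lemma conv_coalg_comp (C D : coalgType K) (A : algType K)
    (u v : {linear D -> A}) (h : {linear C -> D}) x :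
  coalg_map h -> conv u v (h x) = conv (u \o h) (v \o h) x.
Proof. by case=> hD _; rewrite /conv /= hD -tmap_comp. Qed.

Lemma alg_conv (C : coalgType K) (A B : algType K) (a : {lrmorphism A -> B})
    (u v : {linear C -> A}) x : a (conv u v x) = conv (a \o u) (a \o v) x.
Proof.
rewrite /conv /=; elim/tensor_ind: (comul x) => [|c d t IH].
  by rewrite !linear0.
by rewrite !linearD /= IH !tmapE !tmultE rmorphM.
Qed.

Lemma tmap_tmult_tmid (A : algType K) (s t : (A ⊗ A)%type) :
  tmap (@tmult K A) (@tmult K A) (tmid (tens s t)) = s * t.
Proof.
elim/tensor_ind: s => [|a b s IH]; first by rewrite linear0l !linear0 mul0r.
rewrite linearDl !linearD mulrDl /= {}IH; congr (_ + _).
elim/tensor_ind: t => [|a' b' t IH]; first by rewrite !linear0 mulr0.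
rewrite !linearD mulrDr /= {}IH; congr (_ + _).
by rewrite tmidE tmapE /= !tmultE tensM.
Qed.

Lemma tmult_coalg (A : cocBialgType K) : coalg_map (@tmult K A).
Proof.
split; elim/tensor_ind=> [|a b t IH].
- by rewrite !linear0.
- rewrite !linearD /= {}IH; congr (_ + _).
  rewrite tmultE comulM -[comul (tens a b)]/(tcomul _) /tcomul /= tmapE.
  by rewrite tmap_tmult_tmid.
- by rewrite !linear0.
- rewrite !linearD /= {}IH; congr (_ + _).
  by rewrite tmultE counitM [RHS]tcounitE.
Qed.

Lemma conv_coalg (C : cocCoalgType K) (A : cocBialgType K)
    (u v : {linear C -> A}) : coalg_map u -> coalg_map v -> coalg_map (conv u v).
Proof.
move=> cu cv; apply: (@eq_coalg_map _ _ _ (@tmult K A \o (tmap u v \o comul))) => //.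
apply: coalg_map_comp; first exact: tmult_coalg.
by apply: coalg_map_comp; [apply: tmap_coalg|apply: comul_coalg].
Qed.

End Convolution.

Lemma tswap_tmap (K : fieldType) (V V' W W' : lmodType K)
    (f : {linear V -> V'}) (g : {linear W -> W'}) (t : V ⊗ W) :
  tswap (tmap f g t) = tmap g f (tswap t).
Proof.
elim/tensor_ind: t => [|v w t IH]; first by rewrite !linear0.
by rewrite !linearD /= IH !(tmapE, tswapE).
Qed.

(** * Sub-bialgebras cut out by subspaces stable under the action *)

Section SubBialgebra.
Variables (K : fieldType) (A : cocBialgType K) (S : A -> Prop).
Hypothesis sS : subspace S.
Hypothesis S1 : S 1.
Hypothesis SM : forall x y, S x -> S y -> S (x * y).
Hypothesis Sact : forall (phi : {linear A -> K^o}) x, S x -> S (act phi x).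

Let pS : {pred A} := fun x => `[< S x >].
Record sub_carrier := SubCarrier { sub_val : A; _ : sub_val \in pS }.
HB.instance Definition _ := [isSub for sub_val].
HB.instance Definition _ := [Choice of sub_carrier by <:].

Let sub_valP (x : sub_carrier) : S (sub_val x).
Proof. by case: x => x /= /asboolP. Qed.

Fact sub_closed : GRing.subsemialg_closed pS.
Proof.
split; first exact/asboolP.
- split; first exact/asboolP/(subspace0 sS).
  by move=> x y /asboolP Sx /asboolP Sy; apply/asboolP/(subspaceD sS).
- by move=> a x /asboolP Sx; apply/asboolP/(subspaceZ sS).
- by move=> x y /asboolP Sx /asboolP Sy; apply/asboolP/SM.
Qed.

HB.instance Definition _ :=
  GRing.SubChoice_isSubAlgebra.Build K A pS sub_carrier sub_closed.

Let inc : {linear sub_carrier -> A} := val.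

Let inc_inj : injective inc. Proof. exact: val_inj. Qed.

Let inc_exists x : S x -> exists e, inc e = x.
Proof. by move=> /asboolP Sx; exists (SubCarrier Sx). Qed.

(* Stability under [act] makes [comul x] invariant under [p ⊗ p] for any     *)
(* projection [p] onto [S].                                                  *)
Let sub_comul_exists : exists cm : {linear sub_carrier -> sub_carrier ⊗ sub_carrier},
  forall x, tmap inc inc (cm x) = comul (inc x).
Proof.
have [p [pS' pS1 _]] := projection_exists sS (subspace_zero A) (fun x _ x0 => x0).
have [r rE] := linear_lift inc_inj (fun x => inc_exists (pS' x)).
exists (tmap r r \o (comul \o inc)) => x /=; rewrite -tmap_comp.
have -> : tmap (inc \o r) (inc \o r) (comul (inc x)) = tmap p p (comul (inc x)).
  exact: eq_tmap.
apply: tensor_sep => phi psi; rewrite contr_tmap.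
rewrite -[contr _ _]/(act (phi \o p) (inc x)) pS1; last exact/Sact/sub_valP.
by rewrite !(act_swap _ psi) /= pS1 //; apply/Sact/sub_valP.
Qed.

Let sub_comul := sval (cid sub_comul_exists).
Let sub_comulE x : tmap inc inc (sub_comul x) = comul (inc x).
Proof. by rewrite /sub_comul; case: cid. Qed.
Let sub_counit : {linear sub_carrier -> K^o} := counit \o inc.

Fact sub_comulA x : tassoc (tmap sub_comul idfun (sub_comul x)) =
  tmap idfun sub_comul (sub_comul x).
Proof.
have inj3 : injective (tmap inc (tmap inc inc)).
  by apply: tmap_inj => //; apply: tmap_inj.
apply: inj3; rewrite -tmap_comp.
rewrite -tassoc_tmap -tmap_comp.
transitivity (tassoc (tmap (comul \o inc) (idfun \o inc) (sub_comul x))).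
  by congr tassoc; apply: eq_tmap => // y /=; rewrite sub_comulE.
rewrite (tmap_comp comul inc idfun inc) sub_comulE comulA -sub_comulE -tmap_comp.
by apply: eq_tmap => // y /=; rewrite sub_comulE.
Qed.

Fact sub_counitl x : tmap sub_counit idfun (sub_comul x) = tens (1 : K^o) x.
Proof.
have inj2 : injective (tmap (idfun : {linear K^o -> K^o}) inc) by apply: tmap_inj.
apply: inj2; rewrite -tmap_comp.
transitivity (tmap (counit \o inc) (idfun \o inc) (sub_comul x)).
  exact: eq_tmap.
by rewrite (tmap_comp counit inc idfun inc) sub_comulE counitl tmapE.
Qed.

Fact sub_counitr x : tmap idfun sub_counit (sub_comul x) = tens x (1 : K^o).
Proof.
have inj2 : injective (tmap inc (idfun : {linear K^o -> K^o})) by apply: tmap_inj.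
apply: inj2; rewrite -tmap_comp.
transitivity (tmap (idfun \o inc) (counit \o inc) (sub_comul x)).
  exact: eq_tmap.
by rewrite (tmap_comp idfun inc counit inc) sub_comulE counitr tmapE.
Qed.

HB.instance Definition _ := Lmodule_isCoalgebra.Build K sub_carrier
  sub_comulA sub_counitl sub_counitr.

Fact sub_comulC (x : sub_carrier) : tswap (comul x) = comul x.
Proof.
have inj2 : injective (tmap inc inc) by apply: tmap_inj.
by apply: inj2; rewrite -tswap_tmap !sub_comulE comulC.
Qed.

HB.instance Definition _ := Coalgebra_isCocommutative.Build K sub_carrier sub_comulC.

Fact sub_comul1 : comul (1 : sub_carrier) = 1.
Proof.
have inj2 : injective (tmap inc inc) by apply: tmap_inj.
by apply: inj2; rewrite sub_comulE comul1 -!tens1 tmapE.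
Qed.

Fact sub_comulM (x y : sub_carrier) : comul (x * y) = comul x * comul y.
Proof.
have inj2 : injective (tmap inc inc) by apply: tmap_inj.
apply: inj2; rewrite tmapM //.
by rewrite ![tmap inc inc (comul _)]sub_comulE comulM.
Qed.

Fact sub_counit1 : counit (1 : sub_carrier) = 1.
Proof. exact: (@counit1 K A). Qed.

Fact sub_counitM (x y : sub_carrier) : counit (x * y) = counit x * counit y.
Proof. exact: (@counitM K A). Qed.

HB.instance Definition _ := Coalgebra_isBialgebra.Build K sub_carrier
  sub_comul1 sub_comulM sub_counit1 sub_counitM.

Fact sub_val_linear : linear sub_val. Proof. exact: (linearP inc). Qed.

Fact sub_val_monoid : monoid_morphism sub_val. Proof. by []. Qed.

HB.instance Definition _ :=
  GRing.isLinear.Build K sub_carrier A *:%R sub_val sub_val_linear.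
HB.instance Definition _ :=
  GRing.isMonoidMorphism.Build sub_carrier A sub_val sub_val_monoid.

Lemma sub_bialgebra_exists : exists (E : cocBialgType K) (i : bialg_hom E A),
  injective i /\ forall x, S x <-> exists e, i e = x.
Proof.
exists sub_carrier.
exists (@BialgHom K sub_carrier A sub_val
  (fun x => esym (sub_comulE x)) (fun=> erefl)).
split; first exact: val_inj.
by move=> x; split=> [/inc_exists//|[e <-]]; apply: sub_valP.
Qed.

End SubBialgebra.

(** * Lifting, equalizers, and monomorphisms against coalgebra maps *)

Section Homomorphisms.
Variable K : fieldType.

Definition mk_bialg_hom (A B : bialgType K) (f : {linear A -> B})
    (fm : monoid_morphism f) (cf : coalg_map f) : bialg_hom A B :=
  @BialgHom K A B
    (HB.pack (GRing.Linear.sort f) (GRing.isLinear.Build K A B *:%R f (linearP f))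
      (GRing.isMonoidMorphism.Build A B f fm)) cf.1 cf.2.

Definition zero_hom (A B : cocBialgType K) : bialg_hom A B :=
  bialg_comp (from_base B) (to_base A).

Lemma zero_homE (A B : cocBialgType K) x :
  zero_hom A B x = (counit x : K) *: 1.
Proof. by []. Qed.

Lemma coalg_lift (C : coalgType K) (E A : bialgType K) (i : bialg_hom E A)
    (u : {linear C -> A}) :
  injective i -> coalg_map u -> (forall x, exists e, i e = u x) ->
  exists2 u' : {linear C -> E}, coalg_map u' & forall x, i (u' x) = u x.
Proof.
move=> inj cu h; have [u' u'E] := linear_lift inj h.
exists u' => //; split=> x.
  have inj2 : injective (tmap i i) by apply: tmap_inj.
  apply: inj2; rewrite -bialg_comul u'E cu.1 -tmap_comp.
  by apply: eq_tmap => y /=; rewrite u'E.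
by rewrite -(bialg_counit i) u'E cu.2.
Qed.

Lemma hom_lift (T E A : cocBialgType K) (i : bialg_hom E A) (h : bialg_hom T A) :
  injective i -> (forall x, exists e, i e = h x) ->
  exists h' : bialg_hom T E, forall x, i (h' x) = h x.
Proof.
move=> inj im; have [h' ch hE] := coalg_lift inj (bialg_hom_coalg h) im.
have hm : monoid_morphism h'.
  split; first by apply: inj; rewrite hE !rmorph1.
  move=> x y; apply: inj; transitivity (h (x * y)); first exact: hE.
  by rewrite !rmorphM; congr (_ * _); apply/esym/hE.
by exists (mk_bialg_hom hm ch).
Qed.

(** The linear equalizer need not be a subcoalgebra; the condition f(x_1) ⊗ x_2 = g(x_1) ⊗ x_2 cuts
    out the largest subcoalgebra inside it. For g the zero morphism this is the Hopf kernel of f. *)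
Lemma equalizer_exists (A B : cocBialgType K) (f g : bialg_hom A B) :
  exists (E : cocBialgType K) (i : bialg_hom E A),
  [/\ injective i, forall e, f (i e) = g (i e) &
    forall x, tmap f idfun (comul x) = tmap g idfun (comul x) <->
      exists e, i e = x].
Proof.
pose S x := tmap f idfun (comul x) = tmap g idfun (comul x).
have SP x : S x <-> forall chi : {linear B -> K^o},
    act (chi \o f) x = act (chi \o g) x.
  split=> [Sx chi|h]; first by rewrite /act -[LHS](contr_tmap f idfun) Sx contr_tmap.
  by apply: tensor_sep => chi psi; rewrite !contr_tmap; congr (psi _); apply: h.
have [||x y Sx Sy|phi x /SP Sx|E [i [inj im]]] := @sub_bialgebra_exists K A S.
- split=> [|c x y]; rewrite /S ?linear0 // => Sx Sy.
  by rewrite !linearP /= Sx Sy.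
- by rewrite /S comul1 -tens1 !tmapE !rmorph1.
- by rewrite /S comulM !tmapM ?Sx ?Sy // => ? ?; rewrite rmorphM.
- by apply/SP => chi; rewrite act_comm Sx act_comm.
exists E, i; split=> // e.
(* Applying the counit to the remaining leg recovers f = g on the subcoalgebra. *)
have /SP h : S (i e) by apply/im; exists e.
by apply: functional_sep => chi; have := congr1 counit (h chi); rewrite !counit_act.
Qed.

Lemma equalizer_coalg (A B : cocBialgType K) (C : coalgType K)
    (f g : bialg_hom A B) (u : {linear C -> A}) x :
  coalg_map u -> (forall x, f (u x) = g (u x)) ->
  tmap f idfun (comul (u x)) = tmap g idfun (comul (u x)).
Proof. by move=> cu fg; rewrite cu.1 -!tmap_comp; apply: eq_tmap. Qed.

Section Projections.
Variables A B : cocBialgType K.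

Fact tproj1_monoid : monoid_morphism (@tproj1 K A B).
Proof.
split; first by rewrite -tens1 tproj1E counit1 scale1r.
move=> x y; elim/tensor_ind: x => [|a b x IH]; first by rewrite !(linear0, mul0r).
rewrite mulrDl !linearD mulrDl /= {}IH; congr (_ + _).
elim/tensor_ind: y => [|a' b' y IH]; first by rewrite !(linear0, mulr0).
rewrite mulrDr !linearD mulrDr /= {}IH; congr (_ + _).
by rewrite tensM !tproj1E counitM -scalerAl -scalerAr scalerA.
Qed.

Fact tproj2_monoid : monoid_morphism (@tproj2 K A B).
Proof.
split; first by rewrite -tens1 tproj2E counit1 scale1r.
move=> x y; elim/tensor_ind: x => [|a b x IH]; first by rewrite !(linear0, mul0r).
rewrite mulrDl !linearD mulrDl /= {}IH; congr (_ + _).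
elim/tensor_ind: y => [|a' b' y IH]; first by rewrite !(linear0, mulr0).
rewrite mulrDr !linearD mulrDr /= {}IH; congr (_ + _).
by rewrite tensM !tproj2E counitM -scalerAl -scalerAr scalerA.
Qed.

Definition tproj1_hom := mk_bialg_hom tproj1_monoid (@tproj1_coalg K A B).
Definition tproj2_hom := mk_bialg_hom tproj2_monoid (@tproj2_coalg K A B).

End Projections.

Section Pairing.
Variables (C D E : cocCoalgType K) (u : {linear C -> D}) (v : {linear C -> E}).
Hypotheses (cu : coalg_map u) (cv : coalg_map v).

Lemma pairing_coalg : coalg_map (tmap u v \o comul).
Proof. by apply: coalg_map_comp; [apply: tmap_coalg|apply: comul_coalg]. Qed.

Lemma tproj2_pairing x : tproj2 (tmap u v (comul x)) = v x.
Proof.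
rewrite /tproj2 contr_tmap -[in RHS](act_counit x); congr (v _).
by apply: eq_contr => y /=; apply: cu.2.
Qed.

Lemma tproj1_pairing x : tproj1 (tmap u v (comul x)) = u x.
Proof.
rewrite /tproj1 /= tswap_tmap comulC contr_tmap -[in RHS](act_counit x).
by congr (u _); apply: eq_contr => y /=; apply: cv.2.
Qed.

End Pairing.

(* Bialgebra maps that agree after composition with a jointly monic pair are *)
(* equal by definition; the equalizer inside [M ⊗ M] (the kernel pair)       *)
(* extends this to mere coalgebra maps.                                      *)
Lemma jointly_monic_coalg (C : cocCoalgType K) (M X1 X2 : cocBialgType K)
    (m1 : bialg_hom M X1) (m2 : bialg_hom M X2) (u v : {linear C -> M}) :
  (forall (T : cocBialgType K) (a b : bialg_hom T M),
     (forall x, m1 (a x) = m1 (b x)) -> (forall x, m2 (a x) = m2 (b x)) ->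
     forall x, a x = b x) ->
  coalg_map u -> coalg_map v ->
  (forall x, m1 (u x) = m1 (v x)) -> (forall x, m2 (u x) = m2 (v x)) ->
  forall x, u x = v x.
Proof.
move=> mono cu cv uv1 uv2 x.
pose p1 := tproj1_hom M M; pose p2 := tproj2_hom M M.
have [E1 [i1 [inj1 eq1 im1]]] := equalizer_exists (bialg_comp m1 p1) (bialg_comp m1 p2).
have [E2 [i2 [inj2 eq2 im2]]] := equalizer_exists
  (bialg_comp m2 (bialg_comp p1 i1)) (bialg_comp m2 (bialg_comp p2 i1)).
pose w : {linear C -> (M ⊗ M)%type} := tmap u v \o comul.
have cw : coalg_map w by apply: pairing_coalg.
have w1 y : p1 (w y) = u y by apply: tproj1_pairing.
have w2 y : p2 (w y) = v y by apply: tproj2_pairing.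
have [|w' cw' w'E] := coalg_lift inj1 cw.
  move=> y; apply/im1/equalizer_coalg => // z.
  by rewrite -[LHS]/(m1 (p1 (w z))) -[RHS]/(m1 (p2 (w z))) w1 w2; apply: uv1.
have [|w'' cw'' w''E] := coalg_lift inj2 cw'.
  move=> y; apply/im2/equalizer_coalg => // z.
  by rewrite -[LHS]/(m2 (p1 (i1 (w' z)))) -[RHS]/(m2 (p2 (i1 (w' z)))) w'E w1 w2; apply: uv2.
rewrite -w1 -w2 -w'E -w''E.
apply: (mono _ (bialg_comp p1 (bialg_comp i1 i2)) (bialg_comp p2 (bialg_comp i1 i2))).
  by move=> y /=; apply: eq1.
by move=> y /=; apply: eq2.
Qed.

End Homomorphisms.

(** * The antipode is a coalgebra map *)

Section Antipode.
Variables (K : fieldType) (Y : cocBialgType K) (S : {linear Y -> Y}).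
Hypothesis antiS : is_antipode S.

Lemma antipode_convl : conv S idfun =1 @conv_unit K Y Y.
Proof. exact: antiS.1. Qed.

Lemma antipode_convr : conv idfun S =1 @conv_unit K Y Y.
Proof. exact: antiS.2. Qed.

(** The counit is an algebra map, so it sends the identity for S * id to (ε S) * ε = ε, and ε is the
    unit for convolution. *)
Lemma antipode_counit y : counit (S y) = counit y.
Proof.
have h := alg_conv (to_base Y) S idfun y.
rewrite antipode_convl /= in h.
have e : to_base Y \o idfun =1 @conv_unit K Y K^o.
  by move=> z; rewrite /conv_unit /= /GRing.scale /= mulr1.
rewrite (conv1r (to_base Y \o S) e) in h.
rewrite -[LHS]/((to_base Y \o S) y) -h /conv_unit linearZ /= rmorph1.
by rewrite /GRing.scale /= mulr1.
Qed.

Fact comul_monoid : monoid_morphism (comul : {linear Y -> (Y ⊗ Y)%type}).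
Proof. by split; [apply: comul1|apply: comulM]. Qed.

Definition comul_hom : bialg_hom Y (Y ⊗ Y)%type :=
  mk_bialg_hom comul_monoid (@comul_coalg K Y).

Lemma tmult_tmid (s : ((Y ⊗ Y) ⊗ (Y ⊗ Y))%type) :
  tmult (tmap idfun (tmap S S) (tmid s)) =
  tmap (@tmult K Y \o tmap idfun S) (@tmult K Y \o tmap idfun S) s.
Proof.
elim/tensor_ind: s => [|a b s IH]; first by rewrite !linear0.
rewrite !linearD /= {}IH; congr (_ + _).
elim/tensor_ind: a => [|a a' s' IH]; first by rewrite linear0l !linear0.
rewrite linearDl !linearD /= {}IH; congr (_ + _).
elim/tensor_ind: b => [|b b' s'' IH]; first by rewrite !linear0.
rewrite !linearD /= {}IH; congr (_ + _).
by rewrite tmidE !tmapE /= !tmapE !tmultE tensM.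
Qed.

(* [Δ S] and [(S ⊗ S) Δ] are both convolution inverse to [Δ]. *)
Lemma antipode_coalg : coalg_map S.
Proof.
split; last exact: antipode_counit.
pose a : {linear Y -> (Y ⊗ Y)%type} := comul \o S.
pose d : {linear Y -> (Y ⊗ Y)%type} := comul.
pose b : {linear Y -> (Y ⊗ Y)%type} := tmap S S \o comul.
have ad : conv a d =1 @conv_unit K Y (Y ⊗ Y)%type.
  move=> y; have := alg_conv comul_hom S idfun y; rewrite antipode_convl.
  rewrite /conv_unit linearZ rmorph1 => ->.
  exact: eq_conv.
have db : conv d b =1 @conv_unit K Y (Y ⊗ Y)%type.
  move=> y; transitivity (tmult (tmap idfun (tmap S S) (tmap comul comul (comul y)))).
    by rewrite /conv /= -tmap_comp.
  rewrite -(@comul_coalg K Y).1 -[comul (comul y)]/(tmid (tmap comul comul (comul y))).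
  rewrite tmult_tmid -tmap_comp.
  transitivity (tmap (zero_hom Y Y) (zero_hom Y Y) (comul y)).
    by apply: eq_tmap; apply: antipode_convr.
  by rewrite -bialg_comul zero_homE linearZ /= comul1.
move=> y; rewrite -[LHS]/(a y) -[RHS]/(b y).
by rewrite -(conv1r a db y) -convA (conv1l _ ad).
Qed.

End Antipode.

(** * Hopf algebras are protomodular objects *)

Section Category.
Variable K : fieldType.
Local Notation BiAlg := (BiAlg_coc K).

Lemma zero_morP (A B : cocBialgType K) (h : bialg_hom A B) :
  @is_zero_mor BiAlg A B h <-> forall x, h x = zero_hom A B x.
Proof.
split=> [[Z [a [b [Z0 ->]]]] x|h0].
  have [_ [z [_ zuniq]]] := Z0 A.
  have [[z' [_ z'uniq]] _] := @base_is_zero_obj K B.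
  have -> : a = bialg_comp (from_base Z) (to_base A).
    by transitivity z; [apply/esym/zuniq|apply: zuniq].
  have e : bialg_comp b (from_base Z) = from_base B.
    by transitivity z'; [apply/esym/z'uniq|apply: z'uniq].
  exact: (congr1 (fun f : bialg_hom K^o B => f (to_base A x)) e).
exists (K^o : cocBialgType K), (to_base A), (from_base B); split; first exact: base_is_zero_obj.
by apply: bialg_hom_ext => x; rewrite h0.
Qed.

Lemma comp_congr (A B D D' : cocBialgType K) (g : bialg_hom B D) (f : bialg_hom A B)
    (g' : bialg_hom D' D) (f' : bialg_hom A D') x :
  @ccomp BiAlg A B D g f = @ccomp BiAlg A D' D g' f' -> g (f x) = g' (f' x).
Proof. by move=> e; have := congr1 (fun h : bialg_hom A D => h x) e. Qed.

Lemma is_isoP (A B : cocBialgType K) (f : bialg_hom A B) :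
  @is_iso BiAlg A B f <-> bijective f.
Proof.
split=> [[g [gf fg]]|[g gK fK]].
  exists g => x.
    exact: (congr1 (fun h : bialg_hom A A => h x) gf).
  exact: (congr1 (fun h : bialg_hom B B => h x) fg).
have [|g' g'E] := @hom_lift K B A B f (bialg_id B) (can_inj gK).
  by move=> x; exists (g x).
exists g'; split; apply: bialg_hom_ext => x /=.
  by apply: (can_inj gK); apply: g'E.
exact: g'E.
Qed.

Lemma injective_mono (A B : cocBialgType K) (f : bialg_hom A B) :
  injective f -> @is_mono BiAlg A B f.
Proof.
move=> inj T u v uv; apply: bialg_hom_ext => x; apply: inj.
exact: (comp_congr x uv).
Qed.

(* [kap] plays the role of [x |-> x s(f(x))^-1]; the section [sigma] of [m]  *)
(* comes from the decomposition [x' = (1, kap (q x')) ss(p x')].             *)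
Lemma hopf_protomodular (Y : cocBialgType K) :
  is_hopf Y -> protomodular (C := BiAlg) Y.
Proof.
move=> [S antiS] E W g E' [q [[pbE pbU] qs]].
move=> M m mono [k' k'E] [s' s'E].
move: E E' q pbE pbU qs m mono k' k'E s' s'E.
move=> [N X k f s kerk fs] [N' X' kk p ss kerkk pss] /= q pbE pbU qs m mono k' k'E s' s'E.
have fsE y : f (s y) = y by exact: (congr1 (fun h : bialg_hom Y Y => h y) fs).
have pssE y : p (ss y) = y by exact: (congr1 (fun h : bialg_hom W W => h y) pss).
have qsE y : q (ss y) = s (g y) by exact: (comp_congr y qs).
have gpE x : g (p x) = f (q x) by exact: (comp_congr x pbE).
have mk'E x : m (k' x) = kk x by rewrite -k'E.
have ms'E x : m (s' x) = ss x by rewrite -s'E.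
have cS := antipode_coalg antiS.
have [H [i [inji fi imi]]] := equalizer_exists f (zero_hom X Y).
(* The Hopf kernel [H] of [f] enters the pullback as the pair (0, i). It is killed by [p], hence
   factors through [kk] and so through [m]. *)
have [j [pj qj]] : exists j : bialg_hom H X',
    (forall x, p (j x) = zero_hom H W x) /\ (forall x, q (j x) = i x).
  have [|j [[pj qj] _]] := pbU H (zero_hom H W) i.
    apply: bialg_hom_ext => x; rewrite -[RHS]/(f (i x)) fi.
    rewrite -[LHS]/(g (zero_hom H W x)) !zero_homE linearZ rmorph1.
    by rewrite bialg_counit.
  exists j; split=> x.
    exact: (congr1 (fun h : bialg_hom H W => h x) pj).
  exact: (congr1 (fun h : bialg_hom H X => h x) qj).
have [n nE] : exists n : bialg_hom H N', forall x, kk (n x) = j x.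
  have [|n [nE _]] := kerkk.2 H j; first exact/zero_morP.
  by exists n => x; rewrite -[RHS](congr1 (fun h : bialg_hom H X' => h x) nE).
pose j' := bialg_comp k' n.
have mj' x : m (j' x) = j x by rewrite -nE -mk'E.
pose sSf : {linear X -> X} := (s \o S) \o f.
have csSf : coalg_map sSf.
  by do 2?apply: coalg_map_comp => //; apply: bialg_hom_coalg.
have ckap : coalg_map (conv idfun sSf).
  by apply: conv_coalg => //; apply: coalg_map_id.
(* As f s = 1, this is f(x_1) S(f(x_2)) = ε(x) 1. *)
have fkap x : f (conv idfun sSf x) = zero_hom X Y x.
  rewrite alg_conv.
  transitivity (conv (idfun \o f) (S \o f) x).
    by apply: eq_conv => z //=; rewrite fsE.
  rewrite -conv_coalg_comp; last exact: bialg_hom_coalg.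
  by rewrite antipode_convr // /conv_unit bialg_counit.
have [|kap ckap' kapE] := coalg_lift inji ckap.
  move=> x; apply/imi; apply: equalizer_coalg => // y; rewrite fkap.
  by rewrite zero_homE [RHS]zero_homE ckap.2.
pose jk : {linear X' -> M} := (j' \o kap) \o q.
pose sp : {linear X' -> M} := s' \o p.
pose sigma : {linear X' -> M} := conv jk sp.
have csigma : coalg_map sigma.
  apply: conv_coalg; do 2?apply: coalg_map_comp => //; exact: bialg_hom_coalg.
have pms x : p (m (sigma x)) = p x.
  rewrite alg_conv alg_conv conv1l /= ?ms'E ?pssE // => z /=.
  rewrite mj' pj zero_homE /conv_unit ckap'.2.
  by rewrite bialg_counit.
(* After [q], the second factor s' p becomes s f q, and the claim is x_1 s(S(f(x_2))) s(f(x_3)) = x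
   in [X]. *)
have qms x : q (m (sigma x)) = q x.
  rewrite alg_conv alg_conv.
  transitivity (conv (conv idfun sSf \o q) ((s \o f) \o q) x).
    apply: eq_conv => z /=; first by rewrite mj' qj kapE.
    by rewrite ms'E qsE gpE.
  rewrite -[conv idfun sSf \o q]/(_ \o _).
  have cq := bialg_hom_coalg q.
  transitivity (conv (conv idfun sSf) (s \o f) (q x)).
    by rewrite conv_coalg_comp.
  rewrite convA conv1r // => z.
  transitivity (s (conv (S \o f) (idfun \o f) z)); first by rewrite alg_conv.
  rewrite -conv_coalg_comp; last exact: bialg_hom_coalg.
  by rewrite antipode_convl // /conv_unit linearZ rmorph1 bialg_counit.
have msig x : m (sigma x) = x.
  have cm := bialg_hom_coalg m.
  (* The pullback projections are jointly monic for bialgebra maps by uniqueness, hence also for the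
     coalgebra map [m \o sigma]. *)
  apply: (jointly_monic_coalg (m1 := p) (m2 := q) (u := m \o sigma) (v := idfun)).
  - move=> T a b pab qab y.
    have [|t [_ tuniq]] := pbU T (bialg_comp p a) (bialg_comp q a).
      by apply: bialg_hom_ext => z; apply: gpE.
    have ta : t = a by apply: tuniq.
    have tb : t = b.
      by apply: tuniq; split; apply: bialg_hom_ext => z; apply/esym; [apply: pab|apply: qab].
    by rewrite -ta -tb.
  - exact: coalg_map_comp.
  - exact: coalg_map_id.
  - exact: pms.
  - exact: qms.
apply/is_isoP; exists sigma => // x.
(* With [m] as both legs, m sigma m = m can be cancelled to sigma m = id. *)
apply: (jointly_monic_coalg (m1 := m) (m2 := m) (u := sigma \o m) (v := idfun)).
- move=> T a b mab _ y.
  have -> : a = b by apply: mono; apply: bialg_hom_ext => z; apply: mab.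
  by [].
- by apply: coalg_map_comp => //; apply: bialg_hom_coalg.
- exact: coalg_map_id.
- by move=> y; apply: msig.
- by move=> y; apply: msig.
Qed.

Lemma protomodular_strong (Y : cocBialgType K) :
  protomodular (C := BiAlg) Y -> forall E : split_ext (C := BiAlg) Y, strong E.
Proof.
move=> pY E; apply: (pY E Y (@Defs.cid BiAlg Y)).
exists (@Defs.cid BiAlg _); rewrite ccomp1l ccomp1r; split=> //.
split=> [|T u v]; first by rewrite ccomp1l ccomp1r.
rewrite ccomp1l => ->; exists v; split; first by rewrite ccomp1l.
by move=> t [_ <-]; rewrite ccomp1l.
Qed.

End Category.

(** * Joint eigenvectors of commuting operators modulo a subspace *)

Section Eigenvectors.
Variables (K : fieldType) (V : lmodType K).

Definition shift (T : {linear V -> V}) (r : K) (y : V) := T y - r *: y.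

Section PolynomialAction.
Variables (T : {linear V -> V}) (x : V).

Definition pact (p : {poly K}) : V := \sum_(i < size p) p`_i *: iter i T x.

Lemma pact_bound (p : {poly K}) m :
  (size p <= m)%N -> pact p = \sum_(i < m) p`_i *: iter i T x.
Proof.
move=> pm; rewrite /pact (big_ord_widen _ (fun i => p`_i *: iter i T x) pm).
rewrite big_mkcond /=; apply: eq_bigr => i _; case: ltnP => // /(nth_default 0) ->.
by rewrite scale0r.
Qed.

Lemma pactZ (c : K) (p : {poly K}) : pact (c *: p) = c *: pact p.
Proof.
rewrite (pact_bound (size_scale_leq c p)) scaler_sumr.
by apply: eq_bigr => i _; rewrite coefZ scalerA.
Qed.

Lemma pactXsub (r : K) (q : {poly K}) : pact (('X - r%:P) * q) = shift T r (pact q).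
Proof.
have sz : (size (('X - r%:P) * q)%R <= (size q).+1)%N.
  by apply: leq_trans (size_polyMleq _ _) _; rewrite size_XsubC.
rewrite (pact_bound sz) /shift.
under eq_bigr => i _ do rewrite mulrBl coefB coefXM coefCM scalerBl.
rewrite sumrB; congr (_ - _).
  rewrite big_ord_recl /= scale0r add0r linear_sum.
  by apply: eq_bigr => i _; rewrite linearZ.
rewrite (pact_bound (leqnSn _)) scaler_sumr.
by apply: eq_bigr => i _; rewrite scalerA.
Qed.

Lemma pact_prod (rs : seq K) :
  pact (\prod_(r <- rs) ('X - r%:P)) = foldr (shift T) x rs.
Proof.
elim: rs => [|r rs IH] /=; last by rewrite big_cons pactXsub IH.
by rewrite big_nil /pact size_poly1 big_ord1 coefC scale1r.
Qed.

End PolynomialAction.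

Lemma shift_closed (T : {linear V -> V}) (S : V -> Prop) r x :
  subspace S -> (forall y, S y -> S (T y)) -> S x -> S (shift T r x).
Proof.
by move=> sS ST Sx; apply: subspaceB => //; [apply: ST|apply: subspaceZ].
Qed.

Lemma foldr_shift_comm (T U : {linear V -> V}) r rs x :
  (forall y, T (U y) = U (T y)) ->
  foldr (shift T) (shift U r x) rs = shift U r (foldr (shift T) x rs).
Proof.
move=> TU; elim: rs => [//|q rs IH] /=; rewrite {}IH /shift.
set y := foldr _ _ _; rewrite (linearB T) (linearB U) (linearZ_LR T) (linearZ_LR U) /=.
rewrite TU !scalerBr !scalerA [r * q]mulrC !opprB.
by rewrite addrACA [RHS]addrACA; congr (_ + _); apply: addrC.
Qed.

(** When the factors T - r are applied one at a time, some step passes from outside [H] into [H];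
    the vector just before it is an eigenvector modulo [H]. [G] carries along properties preserved
    by each step. *)
Lemma shift_stop (T : {linear V -> V}) (H G : V -> Prop) rs x :
  (forall r y, G y -> G (shift T r y)) -> G x -> ~ H x ->
  H (foldr (shift T) x rs) -> exists y r, [/\ G y, ~ H y & H (shift T r y)].
Proof.
move=> GT Gx nHx; elim: rs => [//|r rs IH] /= Hr.
have [/IH//|nH] := pselect (H (foldr (shift T) x rs)).
exists (foldr (shift T) x rs), r; split=> //.
by elim: rs {IH Hr nH} => //= q rs IH; apply: GT.
Qed.

(** As for commuting matrices: the vectors of [Z] that [T n] scales by a fixed r modulo [H] form a
    subspace stable under all the operators, and induction applies inside it. *)
Lemma joint_eigenvector (T : nat -> {linear V -> V}) (H Z : V -> Prop) n x :
  (forall i j y, T i (T j y) = T j (T i y)) ->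
  subspace H -> (forall i y, H y -> H (T i y)) ->
  subspace Z -> (forall i y, Z y -> Z (T i y)) -> Z x -> ~ H x ->
  (forall k, (k < n)%N -> exists rs, H (foldr (shift (T k)) x rs)) ->
  exists x' (lam : nat -> K), [/\ Z x', ~ H x' &
    forall k, (k < n)%N -> H (shift (T k) (lam k) x')].
Proof.
move=> comm sH HT; elim: n Z x => [|n IH] Z x sZ ZT Zx nHx alg.
  by exists x, (fun=> 0).
have [rs Hrs] := alg n (ltnSn n).
(* The induction hypothesis requires the remaining operators to be algebraic at the new vector
   too. *)
pose G y := Z y /\ forall k, (k < n)%N -> exists rs, H (foldr (shift (T k)) y rs).
have [||y [r [[Zy algy] nHy Hy]]] := @shift_stop (T n) H G rs x _ _ nHx Hrs.
- move=> r y [Zy algy]; split; first exact: shift_closed (ZT n) Zy.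
  move=> k kn; have [qs Hqs] := algy k kn; exists qs.
  by rewrite foldr_shift_comm //; exact: shift_closed (HT n) Hqs.
- by split=> // k kn; apply: alg; apply: ltnW.
have [|i z [Zz Hz]|x' [lam [[Zx' Hx'] nHx' hlam]]] :=
    IH (fun z => Z z /\ H (shift (T n) r z)) y _ _ (conj Zy Hy) nHy algy.
- split=> [|c a b [Za Ha] [Zb Hb]].
    by split; [apply: sZ.1|rewrite /shift linear0 scaler0 subr0; apply: sH.1].
  split; first exact: sZ.2.
  suff -> : shift (T n) r (c *: a + b) = c *: shift (T n) r a + shift (T n) r b.
    exact: sH.2.
  rewrite /shift linearP scalerDr !scalerBr !scalerA [r * c]mulrC opprD.
  by rewrite addrACA.
- split; first exact: ZT.
  suff -> : shift (T n) r (T i z) = T i (shift (T n) r z) by apply: HT.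
  by rewrite /shift comm (linearB (T i)) (linearZ_LR (T i)).
exists x', (fun k => if k == n then r else lam k); split=> // k.
rewrite ltnS leq_eqVlt; case: eqVneq => [-> //|_ /= kn]; exact: hlam.
Qed.

End Eigenvectors.

(** The first n + 1 iterates lie in the span of n vectors, so some nonzero polynomial in [T] kills
    [x]. It splits over [K], and its leading coefficient can be cancelled. *)
Lemma algebraic_split (K : closedFieldType) (V : lmodType K) (T : {linear V -> V})
    (x : V) n (w : 'I_n -> V) (a : nat -> 'I_n -> K) :
  (forall j, iter j T x = \sum_k a j k *: w k) ->
  exists rs, foldr (shift T) x rs = 0.
Proof.
move=> h; pose A : 'M[K]_(n.+1, n) := \matrix_(i, k) a i k.
have [c c0 cA] : exists2 c : 'rV_(n.+1), c != 0 & c *m A = 0.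
  have : kermx A != 0.
    rewrite kermx_eq0 /row_free; apply/negP => /eqP r.
    by have := rank_leq_col A; rewrite r ltnn.
  case/rowV0Pn => c /sub_kermxP cA c0; by exists c.
pose p := rVpoly c.
have p0 : p != 0.
  by apply: contraNneq c0 => p0; rewrite -[c]rVpolyK -/p p0 linear0.
have px : pact T x p = 0.
  rewrite (pact_bound _ _ (size_poly _ _)).
  under eq_bigr => i _ do rewrite h scaler_sumr.
  rewrite exchange_big /=; apply: big1 => k _.
  under eq_bigr => i _ do rewrite scalerA coef_rVpoly_ord.
  rewrite -scaler_suml; suff -> : \sum_i c 0 i * a i k = 0 by rewrite scale0r.
  transitivity ((c *m A) 0 k); last by rewrite cA mxE.
  by rewrite mxE; apply: eq_bigr => i _; rewrite mxE.
have [rs pE] := closed_field_poly_normal p.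
exists rs; rewrite -pact_prod; apply/eqP.
have /esym/eqP := congr1 (pact T x) pE.
by rewrite pactZ px scaler_eq0 lead_coef_eq0 (negPf p0).
Qed.

(** * Weight vectors and grouplike elements *)

Section Weights.
Variable K : closedFieldType.

Lemma subspace_scale_notin (V : lmodType K) (H : V -> Prop) (c : K) x :
  subspace H -> ~ H x -> H (c *: x) -> c = 0.
Proof.
move=> sH nHx Hcx; apply/eqP; apply: contra_notT nHx => c0.
by rewrite -[x]scale1r -(mulVf c0) -scalerA; apply: subspaceZ.
Qed.

(** The operators [act (phi \o pi)] commute by cocommutativity, and at [x] finitely many of them
    determine all, because the coaction of [x] has finite rank. A joint eigenvector modulo [H] has
    eigenvalues phi(g) for one g in [C]; compatibility with the counit and with iterated actions
    makes g grouplike. *)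
Lemma weight_vector (D C : cocCoalgType K) (pi : {linear D -> C})
    (H Z : D -> Prop) (x : D) :
  coalg_map pi ->
  subspace H -> (forall (phi : {linear C -> K^o}) y, H y -> H (act (phi \o pi) y)) ->
  subspace Z -> (forall (phi : {linear C -> K^o}) y, Z y -> Z (act (phi \o pi) y)) -> Z x -> ~ H x ->
  exists x' (g : C), [/\ Z x', ~ H x', grouplike g &
    forall phi : {linear C -> K^o}, H (act (phi \o pi) x' - (phi g : K) *: x')].
Proof.
move=> cpi sH Hact sZ Zact Zx nHx.
have act_pi (phi psi : {linear C -> K^o}) y :
    act (psi \o pi) (act (phi \o pi) y) = act ((psi \o act phi) \o pi) y.
  by rewrite act_act; apply: eq_act => z /=; rewrite coalg_map_act.
have [n [e [phi [tE _]]]] := tensor_finite_rank (tmap pi idfun (comul x)) 0.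
have xE (psi : {linear C -> K^o}) :
    act (psi \o pi) x = \sum_k (psi (e k) : K) *: act (phi k \o pi) x.
  have := congr1 (contr psi) tE; rewrite contr_tmap (linear_sum (contr psi)).
  rewrite -[X in X = _]/(act (psi \o pi) x) => ->.
  by apply: eq_bigr => k _; rewrite /= contrE contr_tmap.
pose f (k : nat) : {linear C -> K^o} :=
  if insub k is Some i then phi i else \0.
have fE (k : 'I_n) : f k = phi k by rewrite /f valK.
pose T k : {linear D -> D} := act (f k \o pi).
(* Searching inside this stable subspace keeps the finite expansion found for [x] valid at the
   eigenvector. *)
pose Z' z := Z z /\ forall psi : {linear C -> K^o},
  act (psi \o pi) z = \sum_k (psi (e k) : K) *: act (phi k \o pi) z.
have [| | | |k kn|x' [lam [[Zx' x'E] nHx' hlam]]] :=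
    @joint_eigenvector K D T H Z' n x _ sH _ _ _ (conj Zx xE) nHx.
- by move=> i j y; apply: act_comm.
- by move=> i y; apply: Hact.
- split; first split; first exact: sZ.1.
    by move=> psi; rewrite linear0 big1 // => k _; rewrite linear0 scaler0.
  move=> c a b [Za aE] [Zb bE]; split; first exact: sZ.2.
  move=> psi; rewrite linearP /= aE bE scaler_sumr -big_split /=.
  by apply: eq_bigr => k _; rewrite linearP scalerDr !scalerA [c * _]mulrC.
- move=> i y [Zy yE]; split; first exact: Zact.
  move=> psi; rewrite act_comm yE linear_sum; apply: eq_bigr => k _.
  by rewrite linearZ /= act_comm.
(* Iterated actions of one functional are actions of its convolution powers, so the iterates of [x]
   stay in the same finite span. *)
- have [psi psiE] : exists psi : nat -> {linear C -> K^o},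
      forall j, iter j (T k) x = act (psi j \o pi) x.
    exists (fun j => iteri j (fun _ p => f k \o act p) counit).
    elim=> [|j IH] /=; last by rewrite IH act_pi.
    by rewrite -[LHS]act_counit; apply: eq_act => z /=; rewrite cpi.2.
  have [|rs rs0] := @algebraic_split K D (T k) x n (fun i => act (phi i \o pi) x)
    (fun j i => psi j (e i)).
    by move=> j; rewrite psiE xE.
  by exists rs; rewrite rs0; apply: sH.1.
pose g := \sum_k lam (val k) *: e k.
have wt (psi : {linear C -> K^o}) : H (act (psi \o pi) x' - (psi g : K) *: x').
  rewrite x'E (linear_sum psi) scaler_suml -sumrB; apply: subspace_sum => // k _.
  have -> : (psi (lam k *: e k) : K) *: x' = (psi (e k) : K) *: (lam k *: x').
    by rewrite linearZ scalerA mulrC.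
  rewrite -scalerBr; apply: subspaceZ => //.
  by have := hlam k (ltn_ord k); rewrite /shift /T fE.
exists x', g; split=> //; split; last first.
  have := wt counit; rewrite (@eq_act _ _ _ counit) => [|z /=]; last by rewrite cpi.2.
  rewrite act_counit -[X in X - _]scale1r -scalerBl.
  by move/(subspace_scale_notin sH nHx') => /eqP; rewrite subr_eq0 => /eqP.
(* The action of a followed by that of b is the action of the single functional [b \o act a]. Its
   eigenvalue is computed in both ways: the value of that functional at g must equal a(g) b(g). *)
apply: tensor_sep => a b; rewrite contrE linearZ /=; apply/eqP.
rewrite -subr_eq0; apply/eqP/(subspace_scale_notin sH nHx').
have Hab := wt (b \o act a); rewrite -act_pi in Hab.
have Hb : H (act (b \o pi) (act (a \o pi) x') - (a g * b g : K) *: x').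
  rewrite -[act (a \o pi) x'](subrK ((a g : K) *: x')) linearD -addrA.
  apply: subspaceD => //; first exact: Hact.
  by rewrite linearZ -scalerA -scalerBr; apply: subspaceZ => //; apply: wt.
suff -> : forall p q : K, (p - q) *: x' =
    (act (b \o pi) (act (a \o pi) x') - q *: x') -
    (act (b \o pi) (act (a \o pi) x') - p *: x').
  exact: subspaceB.
by move=> p q; rewrite opprB [RHS]addrC addrA subrK scalerBl.
Qed.

End Weights.

(** * Lifting grouplike elements along coalgebra maps *)

Section GrouplikeLift.
Variable K : closedFieldType.

(* Take [H] maximal among the subcoalgebras of [D] whose image under [pi]    *)
(* misses [g]: a vector [x'] of weight [d] modulo [H] lies, up to [H] and    *)
(* scaling, above [g], which forces [pi d = g].                              *)
Lemma grouplike_lift (D C E : cocCoalgType K) (pi : {linear D -> C})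
    (mu : {linear D -> E}) (g : C) (h : E) (v : D) :
  coalg_map pi -> coalg_map mu -> grouplike g -> pi v = g ->
  (forall phi : {linear E -> K^o}, act (phi \o mu) v = (phi h : K) *: v) ->
  exists d : D, [/\ grouplike d, pi d = g & mu d = h].
Proof.
move=> cpi cmu gg piv muv.
have g0 : g != 0.
  by apply/eqP => g0; move/eqP: gg.2; rewrite g0 linear0 eq_sym oner_eq0.
pose Q (H : D -> Prop) := [/\ subspace H,
  forall (psi : {linear D -> K^o}) y, H y -> H (act psi y) &
  forall z, H z -> pi z <> g].
have [H [[sH Hact Hg] maxH]] : exists A, Q A /\
    forall B, Q B -> (forall x, A x -> B x) -> forall x, B x -> A x.
  apply: (maximal_exists (A0 := fun z => z = 0)).
    split=> [|psi y ->|z ->]; first exact: subspace_zero.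
      exact: linear0.
    by rewrite linear0; apply/nesym/eqP.
  move=> F neF FQ Ftot; split.
  - by apply: chain_union_subspace => // A /FQ[].
  - move=> psi y [A FA Ay]; exists A => //.
    by have [_ Aact _] := FQ _ FA; apply: Aact.
  - by move=> z [A /FQ[_ _ Ag] Az]; apply: Ag.
have nHv : ~ H v by move=> /Hg.
pose Z z := forall phi : {linear E -> K^o}, act (phi \o mu) z = (phi h : K) *: z.
have [| | |x' [d [Zx' nHx' gd wt]]] := @weight_vector K D D idfun H Z v
  (coalg_map_id D) sH _ _ _ muv nHv.
- by move=> phi y; apply: Hact.
- split=> [phi|c a b Za Zb phi]; first by rewrite linear0 scaler0.
  by rewrite linearP /= Za Zb scalerDr !scalerA mulrC.
- by move=> psi y Zy phi; rewrite act_comm Zy linearZ.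
have wtd (psi : {linear D -> K^o}) : H (act psi x' - (psi d : K) *: x').
  exact: wt.
exists d; split=> //; last first.
  apply: functional_sep => phi; apply/eqP; rewrite -subr_eq0; apply/eqP.
  apply: (subspace_scale_notin sH nHx'); rewrite scalerBl.
  have := wtd (phi \o mu); rewrite Zx' => Hx.
  by rewrite -opprB -scaleN1r; apply: subspaceZ.
apply: functional_sep => phi; apply: contrapT => ne.
(* H + K x' is a strictly larger subcoalgebra, so by maximality its image contains [g]. *)
pose B y := exists c, H (y - c *: x').
have sB : subspace B.
  split=> [|c a b [p Ha] [q Hb]]; first by exists 0; rewrite scale0r subr0; apply: sH.1.
  exists (c * p + q); rewrite scalerDl -scalerA opprD addrACA -scalerBr.
  exact: sH.2.
have Bact (psi : {linear D -> K^o}) y : B y -> B (act psi y).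
  move=> [c Hy]; exists (c * (psi d : K)).
  have -> : act psi y - (c * (psi d : K)) *: x' =
      act psi (y - c *: x') + c *: (act psi x' - (psi d : K) *: x').
    by rewrite (linearB (act psi)) (linearZ_LR (act psi)) scalerBr scalerA /= addrA subrK.
  by apply: subspaceD => //; [apply: Hact|apply: subspaceZ].
have [z [c Hz] piz] : exists2 z, B z & pi z = g.
  apply: contrapT => nz; apply: nHx'; apply: (maxH B).
  - by split=> // z Bz piz; apply: nz; exists z.
  - by move=> x Hx; exists 0; rewrite scale0r subr0.
  - by exists 1; rewrite scale1r subrr; apply: sH.1.
pose a : K := phi g - phi (pi d).
have a0 : a != 0 by rewrite subr_eq0; apply/eqP/nesym.
(* Modulo [H] the functional scales all of H + K x' by phi(pi d) up to elements of [H], but it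
   scales pi z = g by phi(g). The image of this element is therefore a nonzero multiple of [g],
   although it comes from [H]. *)
have Hw : H (act (phi \o pi) z - (phi (pi d) : K) *: z).
  have -> : act (phi \o pi) z - (phi (pi d) : K) *: z =
      (act (phi \o pi) (z - c *: x') - (phi (pi d) : K) *: (z - c *: x'))
      + c *: (act (phi \o pi) x' - (phi (pi d) : K) *: x').
    rewrite (linearB (act _)) (linearZ_LR (act _)) !scalerBr !scalerA [c * _]mulrC opprB /=.
    by rewrite [RHS]addrAC subrKA subrKA.
  apply: subspaceD => //; last by apply: (subspaceZ sH); apply: wtd.
  by apply: subspaceB => //; [apply: Hact|apply: (subspaceZ sH)].
apply: (Hg _ (subspaceZ sH a^-1 Hw)); rewrite linearZ linearB linearZ /=.
by rewrite -coalg_map_act // piz grouplike_act // -scalerBl scalerA mulVf // scale1r.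
Qed.

End GrouplikeLift.

(** * The canonical map and invertibility of grouplikes *)

Section CanonicalMap.
Variables (K : fieldType) (Y : cocBialgType K).

(* $a \otimes b \mapsto a_1 \otimes a_2 b$; its bijectivity is equivalent    *)
(* to the existence of an antipode.                                          *)
Definition can_map : Y ⊗ Y -> Y ⊗ Y :=
  tmap idfun (@tmult K Y) \o (@tassoc K Y Y Y \o tmap comul idfun).
HB.instance Definition _ := GRing.Linear.on can_map.

Lemma can_mapE (a b : Y) : can_map (tens a b) = comul a * tens 1 b.
Proof.
rewrite /can_map /= tmapE /=.
elim/tensor_ind: (comul a) => [|x y t IH]; first by rewrite linear0l !linear0 mul0r.
rewrite linearDl !linearD mulrDl /= {}IH; congr (_ + _).
by rewrite tassocE tmapE /= tmultE tensM mulr1.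
Qed.

Lemma can_mapMr t (b : Y) : can_map (t * tens 1 b) = can_map t * tens 1 b.
Proof.
elim/tensor_ind: t => [|x y t IH]; first by rewrite mul0r !linear0 mul0r.
rewrite mulrDl !linearD mulrDl /= {}IH; congr (_ + _).
by rewrite tensM mulr1 !can_mapE -mulrA tensM mulr1.
Qed.

Lemma tmap_act_comul (phi : {linear Y -> K^o}) (a : Y) :
  tmap (act phi) idfun (comul a) = comul (act phi a).
Proof.
apply: tensor_sep => psi chi; rewrite contr_tmap.
by rewrite -[contr _ _]/(act (psi \o act phi) a) -act_act.
Qed.

(** Colinearity in the first factor makes the kernel and the image of [can_map] stable under the
    action, so that weights can be sought there. *)
Lemma can_map_act (phi : {linear Y -> K^o}) t :
  can_map (tmap (act phi) idfun t) = tmap (act phi) idfun (can_map t).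
Proof.
elim/tensor_ind: t => [|a b t IH]; first by rewrite !linear0.
rewrite !linearD /= {}IH; congr (_ + _).
rewrite tmapE !can_mapE -tmap_act_comul.
elim/tensor_ind: (comul a) => [|x y s IH]; first by rewrite !(linear0, mul0r).
rewrite linearD !mulrDl linearD /= {}IH; congr (_ + _).
by rewrite tmapE !tensM tmapE !mulr1.
Qed.

Lemma contr_counit_can t : contr counit (can_map t) = tmult t.
Proof.
elim/tensor_ind: t => [|a b t IH]; first by rewrite !linear0.
rewrite !linearD /= {}IH; congr (_ + _).
rewrite can_mapE tmultE -[in RHS](act_counit a) /act.
elim/tensor_ind: (comul a) => [|x y s IH]; first by rewrite !(linear0, mul0r).
rewrite linearD !mulrDl linearD /= {}IH; congr (_ + _).
by rewrite tensM mulr1 !contrE scalerAl.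
Qed.

Lemma can_map_tmap (u : {linear Y -> Y}) (y : Y) :
  can_map (tmap idfun u (comul y)) = tmap idfun (conv idfun u) (comul y).
Proof.
rewrite /can_map /= -tmap_comp.
transitivity (tmap idfun (@tmult K Y) (tassoc (tmap (tmap idfun idfun) u
    (tmap comul idfun (comul y))))).
  by rewrite -tmap_comp; congr (tmap _ _ (tassoc _)); apply: eq_tmap => // z /=; rewrite tmap_id.
rewrite tassoc_tmap comulA -!tmap_comp; exact: eq_tmap.
Qed.

(** If tau(y) is the preimage of y ⊗ 1, the antipode is S = (ε ⊗ id) tau. Colinearity gives tau(y) =
    y_1 ⊗ S(y_2), whence id * S is the convolution unit. Then id * S * id = id, and injectivity of
    the canonical map yields the other identity. *)
Lemma can_bijective_hopf : injective can_map ->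
  (forall y, exists t, can_map t = tens y 1) -> is_hopf Y.
Proof.
move=> inj surj.
have lin : linear (fun y : Y => tens y (1 : Y)).
  by move=> c a b; rewrite linearPl.
have [tau tauE] := linear_lift (u := mk_linear lin) inj surj.
have {}tauE y : can_map (tau y) = tens y 1 by exact: tauE.
pose S : {linear Y -> Y} := contr counit \o tau.
have tau_act phi y : tmap (act phi) idfun (tau y) = tau (act phi y).
  by apply: inj; rewrite can_map_act !tauE tmapE.
have tauS y : tau y = tmap idfun S (comul y).
  apply: tensor_sep => phi psi; rewrite contr_tmap; congr (psi _).
  transitivity (S (act phi y)); last by congr (S _); apply: eq_contr.
  by rewrite /S /= -tau_act contr_tmap; apply: eq_contr => z /=; rewrite counit_act.
have convr y : conv idfun S y = @conv_unit K Y Y y.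
  by rewrite /conv /= -tauS -contr_counit_can tauE contrE.
exists S; split=> y; last exact: convr.
have e : tmap idfun (conv S idfun) (comul y) = tens y 1.
  apply: inj; rewrite can_map_tmap can_mapE tens1 mulr1 -[RHS]tmap_id.
  apply: eq_tmap => // z; transitivity (conv (conv idfun S) idfun z).
    exact/esym/convA.
  by rewrite conv1l.
have := congr1 (contr counit) e; rewrite contr_tmap contrE => <-.
transitivity (conv S idfun (act counit y)); first by rewrite act_counit.
by congr (conv _ _ _); apply: eq_contr.
Qed.

End CanonicalMap.

Arguments can_map {K Y}.

(** A nonzero kernel would contain a nonzero weight vector g ⊗ b, which forces g b = 0 and so b = 0.
    A nonzero cokernel is excluded by a weight vector modulo the elements y with y ⊗ 1 in the
    image. *)
Lemma grouplike_invertible_hopf (K : closedFieldType) (Y : cocBialgType K) :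
  (forall g : Y, grouplike g -> exists g', g * g' = 1 /\ g' * g = 1) -> is_hopf Y.
Proof.
move=> inv; apply: can_bijective_hopf.
  suff ker (t : (Y ⊗ Y)%type) : can_map t = 0 -> t = 0.
    move=> s t st; apply/eqP; rewrite -subr_eq0; apply/eqP/ker.
    by rewrite linearB /= st subrr.
  move=> t0; apply: contrapT => nt.
  have [| | |t' [g [Zt' nt' gg wt]]] := @weight_vector K (Y ⊗ Y)%type Y
    (@tproj1 K Y Y) (fun t => t = 0) (fun t => can_map t = 0) t
    (@tproj1_coalg K Y Y) (subspace_zero _) _ _ _ t0 nt.
  - by move=> phi y ->; rewrite linear0.
  - exact: (subspace_ker (can_map)).
  - by move=> phi y y0; rewrite act_tproj1 can_map_act y0 linear0.
  have [g' [_ g'g]] := inv g gg.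
  have t'E : t' = tens g (contr counit t').
    apply: tensor_sep => phi psi; rewrite contrE; congr (psi _).
    have /eqP := wt phi; rewrite subr_eq0 act_tproj1 => /eqP e.
    have := congr1 (contr counit) e; rewrite contr_tmap linearZ /= => <-.
    by apply: eq_contr => z /=; rewrite counit_act.
  apply: nt'; rewrite t'E; set b := contr counit t' in t'E *.
  suff -> : b = 0 by rewrite linear0.
  have := congr1 (contr counit) Zt'; rewrite contr_counit_can t'E tmultE linear0.
  by move=> gb0; rewrite -[b]mul1r -g'g -mulrA gb0 mulr0.
pose H (y : Y) := exists t, can_map t = tens y 1.
have sH : subspace H.
  split=> [|c a b [s sE] [t tE]]; first by exists 0; rewrite linear0 linear0l.
  by exists (c *: s + t); rewrite linearP /= sE tE linearPl.
move=> y; apply: contrapT => nHy.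
have [| | |x [g [_ nHx gg wt]]] := @weight_vector K Y Y idfun H (fun=> True) y
  (coalg_map_id Y) sH _ _ _ I nHy; [|by []|by []|].
  move=> phi z [t tE]; exists (tmap (act phi) idfun t).
  rewrite can_map_act tE tmapE; congr tens; exact: eq_act.
have [g' [gg' _]] := inv g gg.
have [n [e [phi [xE gE]]]] := tensor_finite_rank (comul x) g.
have hH k : H (act (phi k) x - (phi k g : K) *: x) by exact: wt.
pose t k := sval (boolp.cid (hH k)).
have tE k : can_map (t k) = tens (act (phi k) x - (phi k g : K) *: x) 1.
  by rewrite /t; case: boolp.cid.
(* By cocommutativity, x ⊗ g' is sent to the sum of the x_k ⊗ e_k g' with x_k = [act (phi k) x]. The
   correction replaces x_k by phi_k(g) x, and the sum becomes x ⊗ g g' = x ⊗ 1. *)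
apply: nHx; exists (tens x g' - \sum_k t k * tens 1 (e k * g')).
rewrite (linearB can_map) (linear_sum can_map) /= can_mapE -comulC {1}xE.
rewrite (linear_sum (@tswap K Y Y)) mulr_suml -sumrB.
transitivity (\sum_k tens x ((phi k g : K) *: (e k * g'))).
  apply: eq_bigr => k _; rewrite /= tswapE can_mapMr tE !tensM mulr1 !mul1r.
  rewrite -[contr (phi k) (comul x)]/(act (phi k) x) mulr1 linearBl opprB addrC subrK.
  by rewrite linearZl_LR linearZ.
rewrite -linear_sum; congr (tens x _); rewrite -gg' [in RHS]gE mulr_suml.
by apply: eq_bigr => k _; rewrite scalerAl.
Qed.

(** * The test extension attached to a grouplike element *)

Section Extension.
Variables (K : fieldType) (Y : cocBialgType K) (g : Y).
Hypothesis gg : grouplike g.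

Definition ins1 (y : Y) : Y ⊗ Y := tens y 1.
Definition ins2 (y : Y) : Y ⊗ Y := tens 1 y.

Fact ins1_linear : linear ins1.
Proof. by move=> c x y; rewrite /ins1 linearPl. Qed.
HB.instance Definition _ := GRing.isLinear.Build K Y (Y ⊗ Y)%type *:%R ins1 ins1_linear.

Fact ins2_linear : linear ins2.
Proof. by move=> c x y; rewrite /ins2 linearPr. Qed.
HB.instance Definition _ := GRing.isLinear.Build K Y (Y ⊗ Y)%type *:%R ins2 ins2_linear.

Lemma ins1M x y : ins1 (x * y) = ins1 x * ins1 y.
Proof. by rewrite /ins1 tensM mulr1. Qed.

Lemma ins2M x y : ins2 (x * y) = ins2 x * ins2 y.
Proof. by rewrite /ins2 tensM mulr1. Qed.

Lemma ins1_comul y : comul (ins1 y) = tmap ins1 ins1 (comul y).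
Proof.
rewrite comul_tens (@comul1 K Y) -tens1.
elim/tensor_ind: (comul y) => [|a b t IH]; first by rewrite linear0l !linear0.
by rewrite linearDl !linearD /= IH tmidE tmapE.
Qed.

Lemma ins2_comul y : comul (ins2 y) = tmap ins2 ins2 (comul y).
Proof.
rewrite comul_tens (@comul1 K Y) -tens1.
elim/tensor_ind: (comul y) => [|a b t IH]; first by rewrite !linear0.
by rewrite !linearD /= IH tmidE tmapE.
Qed.

Lemma ins1_comulM y z : comul (ins1 y * z) = tmap ins1 ins1 (comul y) * comul z.
Proof. by rewrite -ins1_comul; exact: (@tcomulM K Y Y). Qed.

Lemma ins2_comulM z y : comul (z * ins2 y) = comul z * tmap ins2 ins2 (comul y).
Proof. by rewrite -ins2_comul; exact: (@tcomulM K Y Y). Qed.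

Definition mid : Y ⊗ Y -> Y := @tmult K Y \o tmap idfun (mull g).
HB.instance Definition _ := GRing.Linear.on mid.

Lemma midE a b : mid (tens a b) = a * (g * b).
Proof. by rewrite /mid /= tmapE tmultE. Qed.

Lemma mid_ins1 y z : mid (ins1 y * z) = y * mid z.
Proof.
elim/tensor_ind: z => [|a b z IH]; first by rewrite mulr0 linear0 mulr0.
by rewrite mulrDr !linearD mulrDr /= IH tensM !midE mul1r -mulrA.
Qed.

Lemma mid_ins2 y z : mid (z * ins2 y) = mid z * y.
Proof.
elim/tensor_ind: z => [|a b z IH]; first by rewrite mul0r linear0 mul0r.
by rewrite mulrDl !linearD mulrDl /= IH tensM !midE mulr1 !mulrA.
Qed.

(** Multiplication is a coalgebra map, and so is left multiplication by the grouplike [g]. *)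
Lemma mid_coalg : coalg_map mid.
Proof.
apply: coalg_map_comp; first exact: tmult_coalg.
apply: tmap_coalg; first exact: coalg_map_id.
split=> y; last by rewrite /= /mull counitM gg.2 mul1r.
rewrite /= /mull comulM gg.1.
elim/tensor_ind: (comul y) => [|a b t IH]; first by rewrite mulr0 linear0.
by rewrite mulrDr linearD /= IH tensM tmapE.
Qed.

(* The analogue of the monoid [Y + Y t Y], where [t] is sent to [g] and      *)
(* [t] absorbs elements on its right through [g]: (a t b) x = a t (b f(x)).  *)
Definition ext : Type := (Y * (Y ⊗ Y))%type.
HB.instance Definition _ := GRing.Lmodule.copy ext (Y * (Y ⊗ Y))%type.

Definition ext_in0 (y : Y) : ext := (y, 0).
Definition ext_in1 (z : Y ⊗ Y) : ext := (0, z).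
Definition ext_fun (p : ext) : Y := p.1 + mid p.2.
Definition ext_mul (p q : ext) : ext :=
  (p.1 * q.1, ins1 p.1 * q.2 + p.2 * ins2 (ext_fun q)).
Definition ext_one : ext := ext_in0 1.

Fact ext_in0_linear : linear ext_in0.
Proof.
move=> c x y; apply: (@injective_projections Y (Y ⊗ Y)%type) => //=.
by rewrite scaler0 addr0.
Qed.
HB.instance Definition _ := GRing.isLinear.Build K Y ext *:%R ext_in0 ext_in0_linear.

Fact ext_in1_linear : linear ext_in1.
Proof.
move=> c x y; apply: (@injective_projections Y (Y ⊗ Y)%type) => //=.
by rewrite scaler0 addr0.
Qed.
HB.instance Definition _ :=
  GRing.isLinear.Build K (Y ⊗ Y)%type ext *:%R ext_in1 ext_in1_linear.

Fact ext_fun_linear : linear ext_fun.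
Proof. by move=> c x y; rewrite /ext_fun /= linearP scalerDr addrACA. Qed.
HB.instance Definition _ := GRing.isLinear.Build K ext Y *:%R ext_fun ext_fun_linear.

Lemma ext_eq (p q : ext) : p.1 = q.1 -> p.2 = q.2 -> p = q.
Proof. by case: p q => [a b] [c d] /= -> ->. Qed.

Lemma ext_funM p q : ext_fun (ext_mul p q) = ext_fun p * ext_fun q.
Proof.
rewrite {1}/ext_fun /= linearD /= mid_ins1 mid_ins2.
by rewrite addrA -mulrDr -mulrDl.
Qed.

Fact ext_mulA : associative ext_mul.
Proof.
move=> p q r; apply: ext_eq; rewrite /= ?mulrA // ext_funM ins1M ins2M.
by rewrite mulrDr mulrDl !mulrA addrA.
Qed.

Fact ext_mul1l : left_id ext_one ext_mul.
Proof. by move=> p; apply: ext_eq; rewrite /= ?mul1r // mul0r addr0. Qed.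

Fact ext_mul1r : right_id ext_one ext_mul.
Proof.
move=> p; apply: ext_eq; rewrite /= ?mulr1 // mulr0 add0r.
by rewrite /ext_fun /= linear0 addr0 mulr1.
Qed.

Fact ext_mulDl : left_distributive ext_mul +%R.
Proof.
move=> p q r; apply: ext_eq; rewrite /= ?mulrDl //.
by rewrite linearD mulrDl addrACA.
Qed.

Fact ext_mulDr : right_distributive ext_mul +%R.
Proof.
move=> p q r; apply: ext_eq; rewrite /= ?mulrDr //.
by rewrite (linearD ext_fun) (linearD ins2) !mulrDr addrACA.
Qed.

Fact ext_one_neq0 : ext_one != 0.
Proof. by apply/eqP => /(congr1 fst) /eqP /=; rewrite oner_eq0. Qed.

HB.instance Definition _ := GRing.Zmodule_isNzRing.Build ext
  ext_mulA ext_mul1l ext_mul1r ext_mulDl ext_mulDr ext_one_neq0.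

Fact ext_scalerAl (c : K) (p q : ext) : c *: ext_mul p q = ext_mul (c *: p) q.
Proof.
apply: ext_eq; rewrite /= ?scalerAl //.
by rewrite (linearZ_LR ins1) /= scalerDr -!scalerAl.
Qed.

HB.instance Definition _ := GRing.Lmodule_isLalgebra.Build K ext ext_scalerAl.

Fact ext_scalerAr (c : K) (p q : ext) : c *: ext_mul p q = ext_mul p (c *: q).
Proof.
apply: ext_eq; rewrite /= ?scalerAr //.
by rewrite (linearZ_LR ext_fun) (linearZ_LR ins2) /= scalerDr -!scalerAr.
Qed.

HB.instance Definition _ := GRing.Lalgebra_isAlgebra.Build K ext ext_scalerAr.

Definition ext_comul (p : ext) : ext ⊗ ext :=
  tmap ext_in0 ext_in0 (comul p.1) + tmap ext_in1 ext_in1 (comul p.2).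
Definition ext_counit (p : ext) : K^o := counit p.1 + counit p.2.

Fact ext_comul_linear : linear ext_comul.
Proof.
move=> c x y; rewrite /ext_comul (linearP (comul : {linear Y -> _})).
rewrite (linearP (comul : {linear (Y ⊗ Y)%type -> _})).
rewrite (linearP (tmap ext_in0 ext_in0)) (linearP (tmap ext_in1 ext_in1)).
by rewrite scalerDr addrACA.
Qed.
HB.instance Definition _ :=
  GRing.isLinear.Build K ext (ext ⊗ ext)%type *:%R ext_comul ext_comul_linear.

Fact ext_counit_linear : linear ext_counit.
Proof. by move=> c x y; rewrite /ext_counit !linearP /= scalerDr addrACA. Qed.
HB.instance Definition _ :=
  GRing.isLinear.Build K ext K^o *:%R ext_counit ext_counit_linear.

Lemma ext_comul_in0 y : ext_comul (ext_in0 y) = tmap ext_in0 ext_in0 (comul y).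
Proof. by rewrite /ext_comul /= !linear0 addr0. Qed.

Lemma ext_comul_in1 z : ext_comul (ext_in1 z) = tmap ext_in1 ext_in1 (comul z).
Proof. by rewrite /ext_comul /= !linear0 add0r. Qed.

Lemma ext_in0_counit y : ext_counit (ext_in0 y) = counit y.
Proof. by rewrite /ext_counit /= linear0 addr0. Qed.

Lemma ext_in1_counit z : ext_counit (ext_in1 z) = counit z.
Proof. by rewrite /ext_counit /= linear0 add0r. Qed.

Lemma ext_decomp p : p = ext_in0 p.1 + ext_in1 p.2.
Proof. by apply: ext_eq; rewrite /= ?addr0 ?add0r. Qed.

Lemma ext_linear_eq (V : lmodType K) (u v : {linear ext -> V}) :
  (forall y, u (ext_in0 y) = v (ext_in0 y)) ->
  (forall z, u (ext_in1 z) = v (ext_in1 z)) -> u =1 v.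
Proof. by move=> h0 h1 p; rewrite (ext_decomp p) !linearD h0 h1. Qed.

Fact ext_comulA p :
  tassoc (tmap ext_comul idfun (ext_comul p)) = tmap idfun ext_comul (ext_comul p).
Proof.
have aux (C : coalgType K) (i : {linear C -> ext}) (x : C) :
    (forall x, ext_comul (i x) = tmap i i (comul x)) ->
    tassoc (tmap ext_comul idfun (ext_comul (i x))) =
    tmap idfun ext_comul (ext_comul (i x)).
  move=> iD; rewrite iD -!tmap_comp.
  transitivity (tassoc (tmap (tmap i i) i (tmap comul idfun (comul x)))).
    by rewrite -tmap_comp; congr tassoc; apply: eq_tmap => // y; apply: iD.
  rewrite tassoc_tmap comulA -tmap_comp.
  by apply: eq_tmap => // y; apply/esym/iD.
exact: (ext_linear_eq
  (u := (@tassoc K ext ext ext \o tmap ext_comul idfun) \o ext_comul)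
  (v := tmap idfun ext_comul \o ext_comul)
  (fun y => aux _ ext_in0 y ext_comul_in0) (fun z => aux _ ext_in1 z ext_comul_in1)).
Qed.

Fact ext_comulC p : tswap (ext_comul p) = ext_comul p.
Proof. by rewrite /ext_comul linearD /= !tswap_tmap !comulC. Qed.

Fact ext_counitl p : tmap ext_counit idfun (ext_comul p) = tens (1 : K^o) p.
Proof.
have aux (C : coalgType K) (i : {linear C -> ext}) (x : C) :
    (forall x, ext_counit (i x) = counit x) ->
    tmap ext_counit idfun (tmap i i (comul x)) = tens (1 : K^o) (i x).
  move=> ie; rewrite -tmap_comp.
  transitivity (tmap idfun i (tmap counit idfun (comul x))).
    by rewrite -tmap_comp; apply: eq_tmap => // y; apply: ie.
  by rewrite counitl tmapE.
rewrite {2}(ext_decomp p) /ext_comul linearD linearDr /=.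
by rewrite !aux //; [apply: ext_in1_counit|apply: ext_in0_counit].
Qed.

Fact ext_counitr p : tmap idfun ext_counit (ext_comul p) = tens p (1 : K^o).
Proof. by rewrite -ext_comulC -tswap_tmap ext_counitl tswapE. Qed.

HB.instance Definition _ := Lmodule_isCoalgebra.Build K ext
  ext_comulA ext_counitl ext_counitr.
HB.instance Definition _ := Coalgebra_isCocommutative.Build K ext ext_comulC.

Fact ext_comul1 : comul (1 : ext) = 1.
Proof. by rewrite [LHS]ext_comul_in0 comul1 -!tens1 tmapE. Qed.

Fact ext_comulM (p q : ext) : comul (p * q) = comul p * comul q.
Proof.
rewrite -[comul p]/(ext_comul p) -[comul q]/(ext_comul q) /ext_comul.
rewrite mulrDr !mulrDl.
have mul00 : tmap ext_in0 ext_in0 (comul p.1) * tmap ext_in0 ext_in0 (comul q.1) =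
    tmap ext_in0 ext_in0 (comul (p.1 * q.1)).
  transitivity (tmap ext_in0 ext_in0
      (tmap idfun idfun (comul p.1) * tmap idfun idfun (comul q.1))).
    apply: tmap_mul => x y; apply: ext_eq => //=.
    by rewrite mulr0 mul0r addr0.
  by congr (tmap _ _ _); rewrite !tmap_id comulM.
have mul01 : tmap ext_in0 ext_in0 (comul p.1) * tmap ext_in1 ext_in1 (comul q.2) =
    tmap ext_in1 ext_in1 (comul (ins1 p.1 * q.2)).
  transitivity (tmap ext_in1 ext_in1
      (tmap ins1 ins1 (comul p.1) * tmap idfun idfun (comul q.2))).
    apply: tmap_mul => x y; apply: ext_eq => //=.
      by rewrite mulr0.
    by rewrite mul0r addr0.
  by congr (tmap _ _ _); rewrite tmap_id ins1_comulM.
have mul10 : tmap ext_in1 ext_in1 (comul p.2) * tmap ext_in0 ext_in0 (comul q.1) =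
    tmap ext_in1 ext_in1 (comul (p.2 * ins2 q.1)).
  transitivity (tmap ext_in1 ext_in1
      (tmap idfun idfun (comul p.2) * tmap ins2 ins2 (comul q.1))).
    apply: tmap_mul => x y; apply: ext_eq => /=; rewrite ?mul0r // mulr0 add0r.
    by rewrite /ext_fun /= linear0 addr0.
  by congr (tmap _ _ _); rewrite tmap_id ins2_comulM.
(* In the product of two elements of Y t Y the right one acts through [mid], so its comultiplication
   is transported by [mid_coalg]. *)
have mul11 : tmap ext_in1 ext_in1 (comul p.2) * tmap ext_in1 ext_in1 (comul q.2) =
    tmap ext_in1 ext_in1 (comul (p.2 * ins2 (mid q.2))).
  transitivity (tmap ext_in1 ext_in1
      (tmap idfun idfun (comul p.2) * tmap (ins2 \o mid) (ins2 \o mid) (comul q.2))).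
    apply: tmap_mul => x y; apply: ext_eq => /=; first by rewrite mul0r.
    by rewrite (linear0 ins1) mul0r add0r /ext_fun /= add0r.
  congr (tmap _ _ _).
  by rewrite tmap_id tmap_comp -mid_coalg.1 ins2_comulM.
rewrite mul00 mul01 mul10 mul11 [LHS]/(ext_comul (ext_mul p q)) /ext_comul /=.
rewrite -!addrA; congr (_ + _).
rewrite addrCA [ext_fun q]/(q.1 + mid q.2) (linearD ins2) mulrDr.
by rewrite !linearD.
Qed.

Fact ext_counit1 : counit (1 : ext) = 1.
Proof. by rewrite [LHS]ext_in0_counit counit1. Qed.

Lemma ext_fun_counit (p : ext) : counit (ext_fun p) = ext_counit p.
Proof. by rewrite /ext_fun linearD mid_coalg.2. Qed.

(** The counit factors through the multiplicative map [ext_fun]. *)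
Fact ext_counitM (p q : ext) : counit (p * q) = counit p * counit q.
Proof.
rewrite -![counit _]/(ext_counit _) -!ext_fun_counit -counitM.
by rewrite -ext_funM.
Qed.

HB.instance Definition _ := Coalgebra_isBialgebra.Build K ext
  ext_comul1 ext_comulM ext_counit1 ext_counitM.

Fact ext_fun_monoid : monoid_morphism ext_fun.
Proof.
by split; [rewrite /ext_fun /= linear0 addr0|apply: ext_funM].
Qed.

Fact ext_fun_coalg : coalg_map ext_fun.
Proof.
split=> p; last exact: ext_fun_counit.
rewrite -[comul p]/(ext_comul p) /ext_comul (linearD (tmap ext_fun ext_fun)) /= -!tmap_comp.
rewrite {1}/ext_fun linearD mid_coalg.1 -[in LHS](tmap_id (comul p.1)).
congr (_ + _); apply: eq_tmap => y /=; rewrite /ext_fun /= ?linear0 ?addr0 ?add0r //.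
Qed.

Definition ext_hom : bialg_hom ext Y := mk_bialg_hom ext_fun_monoid ext_fun_coalg.

Fact ext_in0_monoid : monoid_morphism ext_in0.
Proof.
split=> // x y; apply: ext_eq => //=.
by rewrite mulr0 mul0r addr0.
Qed.

Fact ext_in0_coalg : coalg_map ext_in0.
Proof. by split; [apply: ext_comul_in0|apply: ext_in0_counit]. Qed.

Definition ext_section : bialg_hom Y ext := mk_bialg_hom ext_in0_monoid ext_in0_coalg.

Lemma ext_section_fun y : ext_hom (ext_section y) = y.
Proof. by rewrite /= /ext_fun /= linear0 addr0. Qed.

Lemma act_ext_snd (psi : {linear ext -> K^o}) (p : ext) :
  (act psi p).2 = act (psi \o ext_in1) p.2.
Proof.
rewrite /act -[comul p]/(ext_comul p) /ext_comul linearD /= !contr_tmap.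
by rewrite add0r.
Qed.

(* All that is used of [ext]: [f], [s], [j] and [pr] are the retraction, the  *)
(* section, the inclusion of [Y ⊗ Y] and the projection onto it.             *)
Lemma ext_exists : exists (X : cocBialgType K) (f : bialg_hom X Y)
    (s : bialg_hom Y X) (j : {linear (Y ⊗ Y)%type -> X})
    (pr : {linear X -> (Y ⊗ Y)%type}),
  [/\ forall y, f (s y) = y /\ pr (s y) = 0,
      forall z, [/\ pr (j z) = z, f (j z) = mid z & counit (j z) = counit z],
      forall p q, exists a, pr (p * q) = ins1 a * pr q + pr p * ins2 (f q) &
      forall (psi : {linear X -> K^o}) p, pr (act psi p) = act (psi \o j) (pr p)].
Proof.
have lin : linear (snd : ext -> (Y ⊗ Y)%type) by [].
exists ext, ext_hom, ext_section, ext_in1, (mk_linear lin); split.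
- by move=> y; split; [apply: ext_section_fun|].
- move=> z; split=> //; last exact: ext_in1_counit.
  by rewrite -[LHS]/(ext_fun _) /ext_fun /= add0r.
- by move=> p q; exists p.1.
- exact: act_ext_snd.
Qed.

(* That is, [mid w_1 ⊗ w_2 = 1 ⊗ w]. *)
Definition mid_weight (w : Y ⊗ Y) :=
  forall phi : {linear Y -> K^o}, act (phi \o mid) w = (phi 1 : K) *: w.

(** The sub-bimodule of Y ⊗ Y generated by the weight vectors, for multiplication on the outer
    sides; an inductive predicate replaces finite sums. *)
Inductive mid_span : Y ⊗ Y -> Prop :=
| mid_span0 : mid_span 0
| mid_spanD a b w z : mid_weight w -> mid_span z ->
    mid_span (ins1 a * w * ins2 b + z).

Lemma mid_span_add z z' : mid_span z -> mid_span z' -> mid_span (z + z').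
Proof.
by elim=> [|a b w z0 ww _ IH] sz'; rewrite ?add0r // -addrA; apply: mid_spanD; auto.
Qed.

Lemma mid_span_gen a b w : mid_weight w -> mid_span (ins1 a * w * ins2 b).
Proof. by move=> ww; rewrite -[_ * _]addr0; apply: mid_spanD => //; apply: mid_span0. Qed.

Lemma mid_span_ins1 a z : mid_span z -> mid_span (ins1 a * z).
Proof.
elim=> [|a' b w z0 ww _ IH]; first by rewrite mulr0; apply: mid_span0.
by rewrite mulrDr !mulrA -ins1M; apply: mid_spanD.
Qed.

Lemma mid_span_ins2 b z : mid_span z -> mid_span (z * ins2 b).
Proof.
elim=> [|a b' w z0 ww _ IH]; first by rewrite mul0r; apply: mid_span0.
by rewrite mulrDl -!mulrA -ins2M !mulrA; apply: mid_spanD.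
Qed.

Lemma mid_span_subspace : subspace mid_span.
Proof.
split=> [|c x y sx sy]; first exact: mid_span0.
apply: mid_span_add => //.
have -> : c *: x = ins1 (c *: 1) * x by rewrite (linearZ_LR ins1) /= /ins1 tens1 -scalerAl mul1r.
exact: mid_span_ins1.
Qed.

(** A slice of the comultiplication of a w b is a sum of terms a_2 w' b_2 with w' obtained from w by
    an action. Actions commute, so w' satisfies the weight condition again. *)
Lemma mid_span_act (psi : {linear (Y ⊗ Y)%type -> K^o}) z :
  mid_span z -> mid_span (act psi z).
Proof.
elim=> [|a b w z0 ww _ IH]; first by rewrite linear0; apply: mid_span0.
rewrite linearD /=; apply: mid_span_add => // {z0 IH}.
rewrite /act ins2_comulM ins1_comulM.
elim/tensor_ind: (comul a) => [|x x' s IH].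
  by rewrite linear0 !mul0r linear0; apply: mid_span0.
rewrite linearD !mulrDl linearD /=; apply: mid_span_add => // {s IH}.
elim/tensor_ind: (comul b) => [|y y' s IH].
  by rewrite linear0 !mulr0 linear0; apply: mid_span0.
rewrite linearD !mulrDr linearD /=; apply: mid_span_add => // {s IH}.
have lin : linear (fun u => psi (ins1 x * u * ins2 y)).
  by move=> c u v; rewrite mulrDr mulrDl -scalerAr -scalerAl linearP.
have -> : contr psi (tmap ins1 ins1 (tens x x') * comul w * tmap ins2 ins2 (tens y y')) =
    ins1 x' * act (mk_linear lin) w * ins2 y'.
  rewrite /act !tmapE.
  elim/tensor_ind: (comul w) => [|u v t IH]; first by rewrite !(mulr0, mul0r, linear0).
  rewrite mulrDr mulrDl !linearD mulrDr mulrDl /= {}IH; congr (_ + _).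
  by rewrite !tensM !contrE -scalerAr -scalerAl.
apply: mid_span_gen => phi; by rewrite act_comm ww linearZ.
Qed.

Section StrongExtension.
Variables (X : cocBialgType K) (f : bialg_hom X Y) (s : bialg_hom Y X).
Variables (j : {linear (Y ⊗ Y)%type -> X}) (pr : {linear X -> (Y ⊗ Y)%type}).
Hypothesis fsK : forall y, f (s y) = y.
Hypothesis pr_s : forall y, pr (s y) = 0.
Hypothesis jE : forall z, [/\ pr (j z) = z, f (j z) = mid z & counit (j z) = counit z].
Hypothesis prM : forall p q, exists a, pr (p * q) = ins1 a * pr q + pr p * ins2 (f q).
Hypothesis pr_act : forall (psi : {linear X -> K^o}) p,
  pr (act psi p) = act (psi \o j) (pr p).

(** The Hopf kernel condition says that functionals on Y act on [p] through [f] as scalars phi(1).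
    The projection [pr] commutes with actions, and f j = mid. *)
Lemma kernel_weight (p : X) :
  tmap f idfun (comul p) = tmap (zero_hom X Y) idfun (comul p) ->
  mid_weight (pr p).
Proof.
move=> kp phi.
have e : act (phi \o f) p = act (phi \o zero_hom X Y) p.
  have := congr1 (contr phi) kp.
  by rewrite (contr_tmap f idfun phi) (contr_tmap (zero_hom X Y) idfun phi).
have e2 := congr1 pr e; rewrite !pr_act in e2.
transitivity (act ((phi \o f) \o j) (pr p)).
  by apply: eq_act => z /=; have [_ -> _] := jE z.
rewrite e2; apply: act_scale_counit => z.
rewrite -[LHS]/(phi ((counit (j z) : K) *: 1)).
by have [_ _ ->] := jE z; rewrite linearZ mulrC.
Qed.

(** The elements whose Y ⊗ Y component lies in [mid_span] form a sub-bialgebra through which the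
    kernel and the section factor. Strongness makes it everything, in particular it contains t = j(1
    ⊗ 1). *)
Lemma strong_extension_span :
  (forall E : split_ext (C := BiAlg_coc K) Y, strong E) -> mid_span 1.
Proof.
move=> strongY.
have [N [i [inji fi imi]]] := equalizer_exists f (zero_hom X Y).
have ker : @is_kernel (BiAlg_coc K) N X Y i f.
  split; first apply/zero_morP => x.
    by rewrite -[LHS]/(f (i x)) fi !zero_homE bialg_counit.
  move=> T h /zero_morP h0.
  have [|u uE] := hom_lift (h := h) inji.
    move=> x; apply/imi; apply: equalizer_coalg; first exact: bialg_hom_coalg.
    by move=> y; rewrite [LHS]h0 !zero_homE bialg_counit.
  exists u; split=> [|u' u'E]; first exact: bialg_hom_ext.
  apply: bialg_hom_ext => x; apply: inji; rewrite uE.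
  exact/esym/(congr1 (fun f : bialg_hom T X => f x) u'E).
have sec : @ccomp (BiAlg_coc K) Y X Y f s = @Defs.cid (BiAlg_coc K) Y.
  by apply: bialg_hom_ext => y; apply: fsK.
have pr1 : pr 1 = 0 by rewrite -(pr_s 1) rmorph1.
have [|| p q Sp Sq|psi p Sp|M [m [injm imm]]] :=
    @sub_bialgebra_exists K X (fun p => mid_span (pr p)).
- split=> [|c p q Sp Sq]; first by rewrite linear0; apply: mid_span0.
  by rewrite linearP; apply: mid_span_subspace.2.
- by rewrite pr1; apply: mid_span0.
- have [a ->] := prM p q.
  by apply: mid_span_add; [apply: mid_span_ins1|apply: mid_span_ins2].
- by rewrite pr_act; apply: mid_span_act.
have [|k kE] := hom_lift (h := i) injm.
  move=> x; apply/imm.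
  have /imi /kernel_weight wx : exists e, i e = i x by exists x.
  rewrite -[pr (i x)]addr0 -[X in X + 0]mul1r -[X in X + 0]mulr1.
  by apply: (@mid_spanD 1 1) => //; apply: mid_span0.
have [|t tE] := hom_lift (h := s) injm.
  by move=> y; apply/imm; rewrite pr_s; apply: mid_span0.
have := strongY (SplitExt ker sec) M m (injective_mono injm).
case.
- by exists k; apply: bialg_hom_ext.
- by exists t; apply: bialg_hom_ext.
move=> m' [_ mm'].
have [<- _ _] := jE 1; apply/imm; exists (m' (j 1)).
exact: (congr1 (fun h : bialg_hom X X => h (j 1)) mm').
Qed.

End StrongExtension.

Lemma strong_span :
  (forall E : split_ext (C := BiAlg_coc K) Y, strong E) -> mid_span 1.
Proof.
have [X [f [s [j [pr [fs jE prM pra]]]]]] := ext_exists.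
apply: (@strong_extension_span X f s j pr) => // y; first exact: (fs y).1.
exact: (fs y).2.
Qed.

End Extension.

(** * From strong extensions to invertible grouplikes and an antipode *)

Lemma mid_span_weight (K : fieldType) (Y : cocBialgType K) (g : Y) z :
  mid_span g z ->
  exists v : (Y ⊗ (Y ⊗ Y))%type,
    (forall phi : {linear Y -> K^o},
       act (phi \o (mid g \o @tproj2 K Y (Y ⊗ Y)%type)) v = (phi 1 : K) *: v) /\
    tmult (tmap idfun (@tproj1 K Y Y) v) = tproj1 z.
Proof.
elim=> [|a b w z0 ww _ [v [vw vE]]].
  by exists 0; split=> [phi|]; rewrite !linear0 // scaler0.
exists ((counit b : K) *: tens a w + v); split=> [phi|].
  rewrite linearP /= vw scalerDr; congr (_ + _).
  transitivity ((counit b : K) *: act ((phi \o mid g) \o @tproj2 K Y (Y ⊗ Y)%type) (tens a w)).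
    by congr (_ *: _); apply: eq_act.
  by rewrite act_tproj2 tmapE /= ww linearZ /= !scalerA mulrC.
rewrite !linearP /= vE linearD; congr (_ + _).
rewrite tmapE tmultE /=.
rewrite !(tproj1_monoid Y Y).2 /ins1 /ins2 !tproj1E counit1 scale1r.
by rewrite -scalerAr mulr1.
Qed.

Lemma grouplike1 (K : fieldType) (Y : bialgType K) : grouplike (1 : Y).
Proof. by split; [rewrite comul1|apply: counit1]. Qed.

Lemma grouplikeM (K : fieldType) (Y : bialgType K) (g h : Y) :
  grouplike g -> grouplike h -> grouplike (g * h).
Proof.
by move=> [gg g1] [hh h1]; split; rewrite ?comulM ?gg ?hh ?tensM // counitM g1 h1 mulr1.
Qed.

Lemma grouplike_tens (K : fieldType) (C D : cocCoalgType K) (d : (C ⊗ D)%type) :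
  grouplike d -> d = tens (tproj1 d) (tproj2 d).
Proof.
move=> gd; apply: tensor_sep => phi psi; rewrite contrE; congr (psi _).
have := grouplike_act (phi \o @tproj1 K C D) gd; rewrite act_tproj1 => e.
have := congr1 (contr counit) e; rewrite contr_tmap linearZ /= => <-.
by apply: eq_contr => z /=; rewrite counit_act.
Qed.

Lemma strong_grouplike_right_inverse (K : closedFieldType) (Y : cocBialgType K) (g : Y) :
  (forall E : split_ext (C := BiAlg_coc K) Y, strong E) -> grouplike g ->
  exists2 r, grouplike r & g * r = 1.
Proof.
move=> strongY gg.
have [v [vw vE]] := mid_span_weight (strong_span gg strongY).
rewrite (tproj1_monoid Y Y).1 in vE.
pose pi : {linear (Y ⊗ (Y ⊗ Y))%type -> Y} := @tmult K Y \o tmap idfun (@tproj1 K Y Y).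
pose mu : {linear (Y ⊗ (Y ⊗ Y))%type -> Y} := mid g \o @tproj2 K Y (Y ⊗ Y)%type.
have cpi : coalg_map pi.
  apply: coalg_map_comp; first exact: tmult_coalg.
  by apply: tmap_coalg; [apply: coalg_map_id|apply: tproj1_coalg].
have cmu : coalg_map mu.
  by apply: coalg_map_comp; [apply: mid_coalg|apply: tproj2_coalg].
have [d [gd pid mud]] := grouplike_lift cpi cmu (grouplike1 Y) vE vw.
have gd2 := grouplike_map (@tproj2_coalg K Y (Y ⊗ Y)%type) gd.
have galpha := grouplike_map (@tproj1_coalg K Y Y) gd2.
have gbeta := grouplike_map (@tproj2_coalg K Y Y) gd2.
move: pid mud; rewrite /pi /mu /= [in X in X -> _](grouplike_tens gd).
rewrite {2}(grouplike_tens gd2) tmapE tmultE /=.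
set a := tproj1 d; set alpha := tproj1 (tproj2 d); set beta := tproj2 (tproj2 d).
rewrite midE => aalpha agb.
exists (beta * alpha); first exact: grouplikeM.
by rewrite mulrA -[g * beta]mul1r -aalpha -(mulrA a) agb mulr1.
Qed.

Lemma strong_hopf (K : closedFieldType) (Y : cocBialgType K) :
  (forall E : split_ext (C := BiAlg_coc K) Y, strong E) -> is_hopf Y.
Proof.
move=> strongY; apply: grouplike_invertible_hopf => g gg.
have [r gr grE] := strong_grouplike_right_inverse strongY gg.
have [r' _ rr'] := strong_grouplike_right_inverse strongY gr.
have r'E : r' = g by rewrite -[r']mul1r -grE -mulrA rr' mulr1.
by exists r; rewrite grE -{1}r'E.
Qed.

Theorem theorem3p5 (K : closedFieldType) (Y : cocBialgType K) :
  (is_hopf Y <-> forall E : split_ext (C := BiAlg_coc K) Y, strong E) /\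
  (is_hopf Y <-> protomodular (C := BiAlg_coc K) Y).
Proof.
split; split=> [hY|].
- exact/protomodular_strong/hopf_protomodular.
- exact: strong_hopf.
- exact: hopf_protomodular.
- by move/protomodular_strong/strong_hopf.
Qed.
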